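(* Let $\alpha\in(0,1)$ and consider the critical two-sided chameleon dynamics on $\mathbb{Z}$ with success probability $\alpha$. For $p\in(0,1)$ suppose that the initial colours $\{\xi_i(0): i\in\mathbb{Z}\}$ are i.i.d. with $\mathbb{P}(\xi_i(0)=R)=p$ and $\mathbb{P}(\xi_i(0)=B)=1-p$, and let $\mathbb{P}_t$ be the law of $\xi(t)$ on $\{R,B\}^{\mathbb{Z}}$. Then there is $\pi(\alpha,p)\in[0,1]$ such that, as $t\to\infty$, $$\mathbb{P}_t \ \text{ converges weakly to }\ \pi(\alpha,p)\,\delta_{\mathbf R}+\bigl(1-\pi(\alpha,p)\bigr)\,\delta_{\mathbf B}.$$ Moreover, with $\pi(\alpha,0)=0$ and $\pi(\alpha,1)=1$ (the values corresponding to starting from all blue and from all red respectively), the following hold: (i) for every fixed $\alpha\in(0,1)$ the function $p\mapsto\pi(\alpha,p)$ is continuous on $[0,1]$; (ii) for all $\alpha,p\in(0,1)$, $\pi(\alpha,p)=1-\pi(\alpha,1-p)$; in particular $\pi(\alpha,\tfrac12)=\tfrac12$ for all $\alpha\in(0,1)$; (iii) $p^2<\pi(\alpha,p)<2p-p^2$ for all $0<p<1$ and $\alpha\in(0,1)$; (iv) for every $\alpha\in(0,1)$ there exists $\varepsilon=\varepsilon(\alpha)>0$ such that $\pi(\alpha,p)>p$ for all $0<p<\varepsilon$.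
   Context: Critical two-sided chameleon dynamics on $\mathbb{Z}$ with success probability $\alpha$: time is discrete, $t=0,1,2,\dots$. At time $t$ each site $i\in\mathbb{Z}$ carries a colour $\xi_i(t)\in\{R,B\}$ (red or blue); $\xi(t)=(\xi_i(t))_{i\in\mathbb{Z}}$. Let $\{C_R(i,t)\}_{i\in\mathbb{Z},t\ge0}$ and $\{C_B(i,t)\}_{i\in\mathbb{Z},t\ge0}$ be two independent collections of i.i.d. Bernoulli$(\alpha)$ random variables (coin tosses; $1$ is a success, $0$ is a failure), independent of the initial configuration $\xi(0)$. The coin used at site $i$ at time $t$ is $C_{\xi_i(t)}(i,t)$. Put $N_i=\{i-1,i,i+1\}$. All sites update simultaneously: - If $C_{\xi_i(t)}(i,t)=1$ then $\xi_i(t+1)=\xi_i(t)$. - If $C_{\xi_i(t)}(i,t)=0$, then site $i$ keeps its colour if the proportion of successes among the coins used at time $t$ by the sites in $N_i$ having the same colour as $i$ at time $t$ is larger than or equal to the proportion of successes among the coins used at time $t$ by the sites in $N_i$ having the other colour; otherwise it switches to the other colour. (If no site of $N_i$ has the other colour, that colour's proportion is taken to be $0$, so site $i$ keeps its colour.) $\{R,B\}^{\mathbb{Z}}$ carries the product topology and product $\sigma$-algebra. $\delta_{\mathbf R}$ (resp. $\delta_{\mathbf B}$) is the probability measure on $\{R,B\}^{\mathbb{Z}}$ giving mass $1$ to the configuration with all sites red (resp. all sites blue). *)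

(* Defs.v *)
From HB Require Import structures.
From mathcomp Require Import all_boot all_order all_algebra.
From mathcomp Require Import zify.
From mathcomp Require Import all_classical all_reals all_analysis.
Set Implicit Arguments.
Unset Strict Implicit.
Unset Printing Implicit Defensive.
Import Order.TTheory GRing.Theory Num.Theory.
Import numFieldNormedType.Exports.
Local Open Scope classical_set_scope.
Local Open Scope ring_scope.

(* Colours are booleans, so that they carry the library's discrete topology
   and discrete sigma-algebra; [~~ c] is the colour other than [c]. *)
Definition red : bool := true.
Definition blue : bool := false.

Definition config := prod_topology (fun _ : int => bool).

HB.instance Definition _ :=
  Topological.copy config (prod_topology (fun _ : int => bool)).
HB.instance Definition _ := isPointed.Build config (fun=> blue).

Definition cylinders : set (set config) :=
  [set A | exists i c, A = [set x : config | x i = c]].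

HB.instance Definition _ :=
  Measurable.copy config (g_sigma_algebraType cylinders).

Definition all_red : config := fun=> red.
Definition all_blue : config := fun=> blue.

Definition neighbours (i : int) : seq int := [:: i - 1; i; i + 1].

(* [C c j] is the outcome (true = success) of the coin of colour [c] at site
   [j].  When no neighbour has colour [c] this is 0 / 0, which is 0 in [rat]. *)
Definition proportion (C : bool -> int -> bool) (x : config) (i : int)
    (c : bool) : rat :=
  (count (fun j => (x j == c) && C c j) (neighbours i))%:R
  / (count (fun j => x j == c) (neighbours i))%:R.

Definition chameleon_step (C : bool -> int -> bool) (x : config) : config :=
  fun i =>
    if C (x i) i then x i
    else if proportion C x i (~~ x i) <= proportion C x i (x i) then x i
    else ~~ x i.

Fixpoint chameleon (C : bool -> int -> nat -> bool) (x0 : config) (t : nat)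
    : config :=
  if t is s.+1 then chameleon_step (fun c j => C c j s) (chameleon C x0 s)
  else x0.

Lemma measurable_fun_config d (T : measurableType d) (X : T -> config) :
  (forall i, measurable_fun setT (fun w => X w i)) -> measurable_fun setT X.
Proof.
move=> mX; apply: (measurability cylinders) => // _ [A [i [c ->]] <-].
have -> : X @^-1` [set x : config | x i = c] = (fun w => X w i) @^-1` [set c].
  by [].
exact: mX.
Qed.

Lemma measurable_fun_bool_arg d (T : measurableType d)
    (G : bool -> T -> bool) (b : T -> bool) :
  measurable_fun setT b -> (forall a, measurable_fun setT (G a)) ->
  measurable_fun setT (fun w => G (b w) w).
Proof.
move=> mb mG.
rewrite (_ : (fun w => _) = (fun w => if b w then G true w else G false w)).
  exact: measurable_fun_ifT.
by apply/funext => w; case: (b w).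
Qed.

Definition on_neighbours (i : int) (l m r : bool) : int -> bool :=
  fun j => if j == i - 1 then l else if j == i then m else r.

Lemma chameleon_step_local (C : bool -> int -> bool) (x : config) (i : int) :
  chameleon_step C x i =
  chameleon_step
    (fun=> on_neighbours i (C (x (i - 1)) (i - 1)) (C (x i) i)
             (C (x (i + 1)) (i + 1)))
    (on_neighbours i (x (i - 1)) (x i) (x (i + 1))) i.
Proof.
have el l m r : on_neighbours i l m r (i - 1) = l.
  by rewrite /on_neighbours eqxx.
have em l m r : on_neighbours i l m r i = m.
  by rewrite /on_neighbours (_ : i == i - 1 = false) ?eqxx//; lia.
have er l m r : on_neighbours i l m r (i + 1) = r.
  rewrite /on_neighbours (_ : i + 1 == i - 1 = false); last by lia.
  by rewrite (_ : i + 1 == i = false)//; lia.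
rewrite /chameleon_step /proportion /= !(el, em, er).
by case: (x (i - 1)); case: (x i); case: (x (i + 1)).
Qed.

Lemma measurable_chameleon_step d (T : measurableType d)
    (C : bool -> int -> T -> bool) (X : T -> config) :
  (forall c j, measurable_fun setT (C c j)) ->
  (forall j, measurable_fun setT (fun w => X w j)) ->
  forall i,
    measurable_fun setT (fun w => chameleon_step (fun c j => C c j w) (X w) i).
Proof.
move=> mC mX i.
have mCX j : measurable_fun setT (fun w => C (X w j) j w).
  exact: (measurable_fun_bool_arg (G := fun c w => C c j w) (mX j)).
pose F l m r u v z :=
  chameleon_step (fun=> on_neighbours i u v z) (on_neighbours i l m r) i.
rewrite (_ : (fun w => _) =
  fun w => F (X w (i - 1)) (X w i) (X w (i + 1)) (C (X w (i - 1)) (i - 1) w)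
             (C (X w i) i w) (C (X w (i + 1)) (i + 1) w)); last first.
  by apply/funext => w; rewrite chameleon_step_local.
apply: (@measurable_fun_bool_arg _ _
  (fun l w => F l (X w i) (X w (i + 1)) (C (X w (i - 1)) (i - 1) w)
                     (C (X w i) i w) (C (X w (i + 1)) (i + 1) w))
  _ (mX (i - 1))) => l.
apply: (@measurable_fun_bool_arg _ _
  (fun m w => F l m (X w (i + 1)) (C (X w (i - 1)) (i - 1) w)
                     (C (X w i) i w) (C (X w (i + 1)) (i + 1) w))
  _ (mX i)) => m.
apply: (@measurable_fun_bool_arg _ _
  (fun r w => F l m r (C (X w (i - 1)) (i - 1) w)
                     (C (X w i) i w) (C (X w (i + 1)) (i + 1) w))
  _ (mX (i + 1))) => r.
apply: (@measurable_fun_bool_arg _ _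
  (fun u w => F l m r u (C (X w i) i w) (C (X w (i + 1)) (i + 1) w))
  _ (mCX (i - 1))) => u.
apply: (@measurable_fun_bool_arg _ _
  (fun v w => F l m r u v (C (X w (i + 1)) (i + 1) w)) _ (mCX i)) => v.
apply: (@measurable_fun_bool_arg _ _
  (fun z w => F l m r u v z) _ (mCX (i + 1))) => z.
exact: measurable_cst.
Qed.

Definition chameleon_process d (T : measurableType d) (R : realType)
    (P : probability T R) (coin : bool -> int -> nat -> {RV P >-> bool})
    (xi0 : int -> {RV P >-> bool}) (t : nat) : T -> config :=
  fun w => chameleon (fun c i s => coin c i s w) (fun i => xi0 i w) t.

Lemma measurable_chameleon_process d (T : measurableType d) (R : realType)
    (P : probability T R) (coin : bool -> int -> nat -> {RV P >-> bool})
    (xi0 : int -> {RV P >-> bool}) (t : nat) :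
  measurable_fun setT (chameleon_process coin xi0 t).
Proof.
apply: measurable_fun_config.
elim: t => [|t IH] i; first exact: measurable_funPT.
apply: (@measurable_chameleon_step _ _ (fun c j w => coin c j t w)) => // c j.
Qed.

HB.instance Definition _ d (T : measurableType d) (R : realType)
    (P : probability T R) (coin : bool -> int -> nat -> {RV P >-> bool})
    (xi0 : int -> {RV P >-> bool}) (t : nat) :=
  @isMeasurableFun.Build _ _ _ _ (chameleon_process coin xi0 t)
    (measurable_chameleon_process coin xi0 t).

Definition chameleon_law d (T : measurableType d) (R : realType)
    (P : probability T R) (coin : bool -> int -> nat -> {RV P >-> bool})
    (xi0 : int -> {RV P >-> bool}) (t : nat) : probability config R :=
  distribution P (chameleon_process coin xi0 t).

Definition mutually_independent d d' (T : measurableType d)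
    (T' : measurableType d') (R : realType) (P : probability T R) (I : eqType)
    (X : I -> {RV P >-> T'}) : Prop :=
  forall (s : seq I) (A : I -> set T'),
    uniq s -> (forall i, measurable (A i)) ->
    P (\bigcap_(i in [set` s]) (X i @^-1` A i)) =
    (\prod_(i <- s) P (X i @^-1` A i))%E.

(* All coins and initial colours gathered in one family; its mutual
   independence says at once that the coins of each colour and the initial
   colours are independent families and are independent of one another. *)
Definition randomness d (T : measurableType d) (R : realType)
    (P : probability T R) (coin : bool -> int -> nat -> {RV P >-> bool})
    (xi0 : int -> {RV P >-> bool}) (k : (bool * int * nat) + int)
    : {RV P >-> bool} :=
  match k with
  | inl (c, i, t) => coin c i t
  | inr i => xi0 i
  end.

(* As [red] is [true], the Bernoulli(p) law of [xi0 i] gives mass p to red. *)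
Definition chameleon_randomness d (T : measurableType d) (R : realType)
    (alpha p : R) (P : probability T R)
    (coin : bool -> int -> nat -> {RV P >-> bool})
    (xi0 : int -> {RV P >-> bool}) : Prop :=
  [/\ mutually_independent (randomness coin xi0),
      forall c i t A, distribution P (coin c i t) A = bernoulli_prob alpha A &
      forall i A, distribution P (xi0 i) A = bernoulli_prob p A].

Definition weakly_converges (R : realType) (mu : nat -> probability config R)
    (nu : probability config R) : Prop :=
  forall f : config -> R, continuous f -> bounded_fun f ->
    (\int[mu t]_x (f x)%:E)%E @[t --> \oo] --> (\int[nu]_x (f x)%:E)%E.

Definition mixture d (T : measurableType d) (R : realType) (a : {i01 R})
    (mu nu : probability T R) : set T -> \bar R :=
  measure_add (mscale a%:num%:nng mu) (mscale (1 - a%:num)%:nng nu).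

HB.instance Definition _ d (T : measurableType d) (R : realType) (a : {i01 R})
    (mu nu : probability T R) := Measure.on (mixture a mu nu).

Lemma mixture_setT d (T : measurableType d) (R : realType) (a : {i01 R})
    (mu nu : probability T R) : mixture a mu nu setT = 1%E.
Proof.
have -> : mixture a mu nu setT =
    (a%:num%:E * mu setT + (1 - a%:num)%:E * nu setT)%E.
  exact: measure_addE.
by rewrite !probability_setT !mule1 -EFinD addrC subrK.
Qed.

HB.instance Definition _ d (T : measurableType d) (R : realType) (a : {i01 R})
    (mu nu : probability T R) :=
  Measure_isProbability.Build _ _ _ (mixture a mu nu) (mixture_setT a mu nu).

(* Main.v *)
Require Import Defs.
From mathcomp Require Import all_boot all_order all_algebra.
From mathcomp Require Import zify ring lra.
From mathcomp Require Import all_classical all_reals all_analysis.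
Import Order.TTheory GRing.Theory Num.Theory.
Import numFieldNormedType.Exports.
Local Open Scope classical_set_scope.
Local Open Scope ring_scope.
Set Implicit Arguments.
Unset Strict Implicit.
Unset Printing Implicit Defensive.

(** A site changes colour exactly when its own coin fails and the coin of some
    neighbour of the other colour succeeds, so the interfaces between blocks of
    equal colour perform annihilating lazy random walks.  Let [r t] be the
    density of red at time [t], [f t] the probability of the word red-blue, and
    [q = alpha (1 - alpha)].  Translation invariance gives
      [r (t+1) - r t = alpha q (P_t(BRB) - P_t(RBR))]  and
      [f t - f (t+1) >= q (1 + (1 - alpha)^2) (P_t(BRB) + P_t(RBR))],
    whence [|r (t+1) - r t| <= kappa (f t - f (t+1))] with
    [kappa = alpha / (1 + (1 - alpha)^2) < 1].  As [f 0 = p (1 - p)], the limit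
    of [r t] is at distance at most [kappa p (1 - p)] from [p].
    A red run of given length shrinks to a singleton with probability bounded
    below, and singletons are summable in time with total O(p); long runs have
    few ends.  So [f t <= e p] for large [t], uniformly in [p].  This gives the
    clustering behind weak convergence, and makes the limit of [r t] a uniform
    limit of polynomials in [p].  For small [p], the word BRB has probability of
    order [p] at time 0 whereas RBR needs two red sites in a finite light cone,
    hence has probability O(p^2) at each fixed time: red gains. *)

(** * Words seen on consecutive sites *)

(* [cl], [cm], [cr] are the coins actually used by the three sites. *)
Definition next_colour (l m r cl cm cr : bool) : bool :=
  if ~~ cm && (((l != m) && cl) || ((r != m) && cr)) then ~~ m else m.

Fixpoint word_step (v c : seq bool) : seq bool :=
  match v, c with
  | l :: ((m :: r :: _) as v'), cl :: ((cm :: cr :: _) as c') =>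
      next_colour l m r cl cm cr :: word_step v' c'
  | _, _ => [::]
  end.

Arguments word_step : simpl nomatch.

(** Recursion on the length makes sums over words of a given small length unfold into explicit sums
    within reach of [ring]. *)
Fixpoint wsum (V : nmodType) n (f : seq bool -> V) : V :=
  if n is n'.+1 then
    wsum n' (fun w => f (true :: w)) + wsum n' (fun w => f (false :: w))
  else f [::].

Fixpoint bern (R : realFieldType) (a : R) (w : seq bool) : R :=
  if w is b :: w' then (if b then a else 1 - a) * bern a w' else 1.

(* Probability of the word [w] (with [true] for red) on consecutive sites at
   time [t]; [v] and [c] are the colours and the coins used at time [s] on the
   window enlarged by one site on each side.  In lemma names, R and B stand for
   the letters [true] and [false]. *)
Fixpoint law (R : realFieldType) (al p : R) t w : R :=
  if t is s.+1 then
    wsum (size w).+2 (fun v => wsum (size w).+2 (fun c =>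
      bern al c * law al p s v * (word_step v c == w)%:R))
  else bern p w.

Lemma lt01W (R : numDomainType) (x : R) : 0 < x < 1 -> 0 <= x <= 1.
Proof. by case/andP=> *; rewrite !ltW. Qed.

Lemma law0 (R : realFieldType) (al p : R) w : law al p 0 w = bern p w.
Proof. by []. Qed.

Lemma wsumS (V : nmodType) n (f : seq bool -> V) :
  wsum n.+1 f = wsum n (fun w => f (true :: w)) + wsum n (fun w => f (false :: w)).
Proof. by []. Qed.

Lemma lawS (R : realFieldType) (al p : R) t w : law al p t.+1 w =
  wsum (size w).+2 (fun v => wsum (size w).+2 (fun c =>
      bern al c * law al p t v * (word_step v c == w)%:R)).
Proof. by []. Qed.

Arguments law : simpl never.

Lemma eq_wsum (V : nmodType) n (f g : seq bool -> V) :
  (forall w, size w = n -> f w = g w) -> wsum n f = wsum n g.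
Proof.
elim: n f g => [|n IHn] f g fg /=; first exact: fg.
by congr (_ + _); apply: IHn => w sw; apply: fg; rewrite /= sw.
Qed.

Lemma wsumD (V : nmodType) n (f g : seq bool -> V) :
  wsum n (fun w => f w + g w) = wsum n f + wsum n g.
Proof. by elim: n f g => //= n IHn f g; rewrite !IHn addrACA. Qed.

Lemma wsumMl (R : pzRingType) n a (f : seq bool -> R) :
  wsum n (fun w => a * f w) = a * wsum n f.
Proof. by elim: n f => //= n IHn f; rewrite !IHn mulrDr. Qed.

Lemma wsumMr (R : pzRingType) n a (f : seq bool -> R) :
  wsum n (fun w => f w * a) = wsum n f * a.
Proof. by elim: n f => //= n IHn f; rewrite !IHn mulrDl. Qed.

Lemma exchange_wsum (V : nmodType) n k (f : seq bool -> seq bool -> V) :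
  wsum n (fun v => wsum k (f v)) = wsum k (fun c => wsum n (f^~ c)).
Proof.
elim: n f => //= n IHn f.
by rewrite !IHn -wsumD; apply: eq_wsum.
Qed.

Lemma wsum_rcons (V : nmodType) n (f : seq bool -> V) :
  wsum n.+1 f = wsum n (fun w => f (rcons w true) + f (rcons w false)).
Proof.
elim: n f => // n IHn f.
change (wsum n.+1 (fun w => f (true :: w)) + wsum n.+1 (fun w => f (false :: w))
  = wsum n.+1 (fun w => f (rcons w true) + f (rcons w false))).
by rewrite 2!IHn.
Qed.

Lemma ler_wsum (R : numDomainType) n (f g : seq bool -> R) :
  (forall w, size w = n -> f w <= g w) -> wsum n f <= wsum n g.
Proof.
elim: n f g => [|n IHn] f g fg /=; first exact: fg.
by apply: lerD; apply: IHn => w sw; apply: fg; rewrite /= sw.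
Qed.

Lemma wsum0 (V : nmodType) n : wsum n (fun=> 0 : V) = 0.
Proof. by elim: n => //= n ->; rewrite addr0. Qed.

Lemma wsum_ge0 (R : numDomainType) n (f : seq bool -> R) :
  (forall w, size w = n -> 0 <= f w) -> 0 <= wsum n f.
Proof. by move=> f0; rewrite -(wsum0 R n); apply: ler_wsum. Qed.

Lemma wsum_ge (R : numDomainType) n (f : seq bool -> R) w :
  (forall v, size v = n -> 0 <= f v) -> size w = n -> f w <= wsum n f.
Proof.
elim: n f w => [|n IHn] f [|b w] //= f0 [sw].
have h b' : 0 <= wsum n (fun v => f (b' :: v)).
  by apply: wsum_ge0 => v sv; apply: f0; rewrite /= sv.
have := IHn (fun v => f (b :: v)) w.
case: b => /= /(_ _ sw) le.
  by rewrite -[leLHS]addr0 lerD// le// => v sv; apply: f0; rewrite /= sv.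
by rewrite -[leLHS]add0r lerD// le// => v sv; apply: f0; rewrite /= sv.
Qed.

Lemma wsum_pick (R : pzRingType) n u (f : seq bool -> R) :
  size u = n -> wsum n (fun w => (u == w)%:R * f w) = f u.
Proof.
elim: n u f => [|n IHn] [|b u] f //= => [_|[su]]; first by rewrite mul1r.
have e b' : wsum n (fun w => (b :: u == b' :: w)%:R * f (b' :: w)) =
    if b == b' then f (b' :: u) else 0.
  case: ifPn => bb'; last first.
    by rewrite -(wsum0 R n); apply: eq_wsum => w _; rewrite eqseq_cons (negbTE bb') mul0r.
  rewrite -(IHn u (fun w => f (b' :: w)) su); apply: eq_wsum => w _.
  by rewrite eqseq_cons bb'.
by rewrite !e; case: (b); rewrite ?addr0 ?add0r.
Qed.

Lemma size_word_step v c n :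
  size v = n.+2 -> size c = n.+2 -> size (word_step v c) = n.
Proof.
elim: n v c => [|n IHn] [|l [|m [|r v]]] [|cl [|cm [|cr c]]] //= [sv] [sc].
by congr _.+1; apply: (IHn (m :: r :: v) (cm :: cr :: c)); rewrite /= ?sv ?sc.
Qed.

Lemma word_step_cons l cl v c n : size v = n.+2 -> size c = n.+2 ->
  word_step (l :: v) (cl :: c) =
  next_colour l (nth false v 0) (nth false v 1)
    cl (nth false c 0) (nth false c 1) :: word_step v c.
Proof. by case: v => [|m [|r v]]; case: c => [|cm [|cr c]]. Qed.

(** The last letter stays existential because [law_rcons] sums over both of its values. *)
Lemma word_step_rcons r cr v c n : size v = n.+2 -> size c = n.+2 ->
  exists x, word_step (rcons v r) (rcons c cr) = rcons (word_step v c) x.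
Proof.
elim: n v c => [|n IHn].
  case=> [|l [|m [|? ?]]] [|cl [|cm [|? ?]]]//= _ _.
  by eexists; rewrite [RHS]/=; reflexivity.
case=> [|l [|m [|r' v]]] [|cl [|cm [|cr' c]]]//= [sv] [sc].
have [x /= ->] : exists x, word_step (rcons [:: m, r' & v] r)
    (rcons [:: cm, cr' & c] cr) = rcons (word_step [:: m, r' & v] [:: cm, cr' & c]) x.
  by apply: IHn; rewrite /= ?sv ?sc.
by exists x.
Qed.

Lemma word_stepN v c : word_step (map negb v) c = map negb (word_step v c).
Proof.
elim: v c => [|l [|m [|r v]] IHv] [|cl [|cm [|cr c]]] //=.
congr (_ :: _); first by case: l m r cl cm cr {IHv} => [] [] [] [] [] [].
exact: IHv [:: cm, cr & c].
Qed.

Lemma wsumN (V : nmodType) n (f : seq bool -> V) :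
  wsum n (fun w => f (map negb w)) = wsum n f.
Proof. by elim: n f => //= n IHn f; rewrite addrC (IHn (fun w => f (false :: w)))
  (IHn (fun w => f (true :: w))). Qed.

Lemma wsum_bern (R : realFieldType) (a : R) n : wsum n (bern a) = 1.
Proof. by elim: n => //= n IHn; rewrite !wsumMl IHn; ring. Qed.

Lemma bern_rcons (R : realFieldType) (a : R) w b :
  bern a (rcons w b) = bern a w * (if b then a else 1 - a).
Proof. by elim: w => [|c w IHw] /=; rewrite ?mulr1 ?mul1r// IHw mulrA. Qed.

Lemma bernN (R : realFieldType) (a : R) w : bern a (map negb w) = bern (1 - a) w.
Proof. by elim: w => //= b w ->; case: b; rewrite //= subKr. Qed.

Lemma bern_ge0 (R : realFieldType) (a : R) w : 0 <= a <= 1 -> 0 <= bern a w.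
Proof.
move=> /andP[a0 a1]; elim: w => //= b w IHw.
by rewrite mulr_ge0//; case: b; rewrite ?subr_ge0.
Qed.

(** * Alternating subwords are inherited from the past *)

Fixpoint alternate s k : seq bool :=
  if k is k'.+1 then s :: alternate (~~ s) k' else [::].

Lemma subseq_alternate_skip s k b v :
  b != s -> subseq (alternate s k) (b :: v) = subseq (alternate s k) v.
Proof.
by case: k => [|k] bs; rewrite ?sub0seq//= eq_sym (negbTE bs).
Qed.

(* Every site takes its colour from a site at distance at most one, and this
   choice of ancestor is monotone in the site, so no alternation is created. *)
Lemma subseq_alternate_step s k v c :
  subseq (alternate s k) (word_step v c) -> subseq (alternate s k) v.
Proof.
have [n] := ubnP (size v); elim: n s k v c => // n IHn s k v c.
case: k => [|k] sv; first by move=> _; exact: sub0seq.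
case: v c sv => [|l [|m [|r v]]] [|cl [|cm [|cr c]]] // sv.
have sv1 : (size [:: m, r & v] < n)%N by [].
have IH1 s' k' := IHn s' k' [:: m, r & v] [:: cm, cr & c] sv1.
rewrite [word_step _ _]/= -[X in _ :: X]/(word_step [:: m, r & v] [:: cm, cr & c]).
have [ys|ys] := eqVneq (next_colour l m r cl cm cr) s; last first.
  rewrite subseq_alternate_skip// => /(IH1 s k.+1) h.
  exact: subseq_trans h (subseq_cons _ _).
rewrite ys [X in X -> _]/= eqxx => h.
have [ls|ls] := eqVneq l s; first by rewrite ls /= eqxx; exact: IH1 h.
rewrite subseq_alternate_skip//.
have [ms|ms] := eqVneq m s.
  have := IH1 _ _ h; rewrite ms subseq_alternate_skip//; last by case: (s).
  by rewrite /= eqxx.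
rewrite subseq_alternate_skip//.
(* Neither [l] nor [m] has colour [s], so the new letter was copied from [r], whose coin succeeded.
   Hence [r] keeps colour [s], and the rest of the alternation, which starts with the other colour,
   skips that letter. *)
have [cr1 rs] : cr /\ r = s.
  move: ys ls ms; rewrite /next_colour.
  by case: (s); case: (l); case: (m); case: (r); case: (cl); case: (cm); case: (cr).
rewrite rs /= eqxx.
case: v c sv sv1 IH1 h => [|q v] [|cq c] sv sv1 IH1 h.
- by move: h; rewrite [word_step _ _]/=; case: (k).
- by move: h; rewrite [word_step _ _]/=; case: (k).
- by move: h; rewrite [word_step _ _]/=; case: (k).
have sv2 : (size [:: r, q & v] < n)%N by rewrite (leq_trans _ sv1).
have h' : subseq (alternate (~~ s) k) (word_step [:: r, q & v] [:: cr, cq & c]).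
  move: h; rewrite [word_step _ _]/= -[X in _ :: X]/(word_step [:: r, q & v] [:: cr, cq & c]).
  by rewrite subseq_alternate_skip// /next_colour cr1 /= rs; case: (s).
have := IHn _ _ _ _ sv2 h'.
by rewrite rs subseq_alternate_skip//; case: (s).
Qed.

(** * Evolution of the densities of red and of interfaces *)

Section Law.
Variables (R : realFieldType) (al p : R).
Local Notation law := (law al p).

(** An extra site on the left leaves the other output letters unchanged and adds exactly one letter;
    its colour is summed out by induction and its coin weights add up to 1. *)
Lemma law_cons t w : law t w = law t (true :: w) + law t (false :: w).
Proof.
elim: t w => [w|t IHt w]; first by rewrite !law0 /=; ring.
have step b : law t.+1 (b :: w) = wsum (size w).+2 (fun v =>
    wsum (size w).+2 (fun c =>
      let F x y := (if y then al else 1 - al) * bern al c * law t (x :: v) *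
        (word_step (x :: v) (y :: c) == b :: w)%:R in
      F true true + F true false + (F false true + F false false))).
  rewrite lawS [size _]/= wsumS -wsumD; apply: eq_wsum => v sv.
  by rewrite [X in X + _]wsumS [X in _ + X]wsumS -!wsumD; apply: eq_wsum.
rewrite !step lawS -wsumD; apply: eq_wsum => v sv.
rewrite -wsumD; apply: eq_wsum => c sc /=.
rewrite !(word_step_cons _ _ sv sc) !eqseq_cons (IHt v).
by do 4! case: next_colour; rewrite /= !(mulr0, add0r, addr0); ring.
Qed.

Lemma law_rcons t w : law t w = law t (rcons w true) + law t (rcons w false).
Proof.
elim: t w => [w|t IHt w]; first by rewrite !law0 !bern_rcons; ring.
have step b : law t.+1 (rcons w b) = wsum (size w).+2 (fun v =>
    wsum (size w).+2 (fun c =>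
      let F x y := bern al (rcons c y) * law t (rcons v x) *
        (word_step (rcons v x) (rcons c y) == rcons w b)%:R in
      F true true + F true false + (F false true + F false false))).
  rewrite lawS size_rcons wsum_rcons; apply: eq_wsum => v sv.
  by rewrite [X in X + _]wsum_rcons [X in _ + X]wsum_rcons -wsumD; apply: eq_wsum.
rewrite !step lawS -wsumD; apply: eq_wsum => v sv.
rewrite -wsumD; apply: eq_wsum => c sc /=.
have h x y : exists z, word_step (rcons v x) (rcons c y) = rcons (word_step v c) z.
  exact: word_step_rcons sv sc.
have [z1 ->] := h true true; have [z2 ->] := h true false.
have [z3 ->] := h false true; have [z4 ->] := h false false.
rewrite !eqseq_rcons (IHt v) !bern_rcons.
by case: z1; case: z2; case: z3; case: z4;
  rewrite /= ?andbT ?andbF /= !(mulr0, add0r, addr0); ring.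
Qed.

Lemma wsum_law t n : wsum n (law t) = law t [::].
Proof.
elim: n => // n <-; rewrite wsum_rcons; apply: eq_wsum => w _.
by rewrite -law_rcons.
Qed.

Lemma law_nil t : law t [::] = 1.
Proof.
elim: t => // t IHt.
transitivity (wsum 2 (bern al) * wsum 2 (law t)); first by rewrite lawS /=; ring.
by rewrite wsum_bern wsum_law IHt mulr1.
Qed.

Lemma law_RB_BR t : law t [:: true; false] = law t [:: false; true].
Proof.
have := law_cons t [:: true]; have := law_rcons t [:: true] => /=; lra.
Qed.

(** A site flips with probability [al * (1 - al)] if one neighbour is opposite and
    [al * (1 - al) * (2 - al)] if both are. At the first rate per interface, gains and losses would
    balance; what remains is the deficit [al ^+ 2 * (1 - al)] of the second against twice the
    first. *)
Lemma law_red_succ t :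
  law t.+1 [:: true] = law t [:: true] +
    al ^+ 2 * (1 - al) * (law t [:: false; true; false] - law t [:: true; false; true]).
Proof.
have h := law_cons t; have h' := law_rcons t.
have e1 := h [:: true; true]; have e2 := h [:: true; false]; have e3 := h [:: false; true].
have f1 := h' [:: true; true]; have f2 := h' [:: true; false]; have f3 := h' [:: false; true].
have g1 := h [:: true]; have g2 := h' [:: true].
rewrite lawS; rewrite /= in e1 e2 e3 f1 f2 f3 g1 g2 *.
(* By consistency, [u], [w], [x] and [y] determine all 3-letter marginals. *)
set u := law t [:: false; true; false] in e1 e2 e3 f1 f2 f3 g1 g2 *.
set w := law t [:: true; false; true] in e1 e2 e3 f1 f2 f3 g1 g2 *.
set x := law t [:: true; false] in e1 e2 e3 f1 f2 f3 g1 g2 *.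
set y := law t [:: true; true; true] in e1 e2 e3 f1 f2 f3 g1 g2 *.
have -> : law t [:: true; true; false] = x - u by lra.
have -> : law t [:: true; false; false] = x - w by lra.
have -> : law t [:: false; true; true] = x - u by lra.
have -> : law t [:: false; false; true] = x - w by lra.
have -> : law t [:: true] = y + 2 * x - u by lra.
ring.
Qed.

(* A flipping singleton destroys two interfaces.  The quadratic terms come from
   two adjacent sites flipping together: two singletons then destroy only two
   interfaces in total, and a block of length two disappears. *)
Lemma law_RB_succ t :
  law t.+1 [:: true; false] = law t [:: true; false] -
    al * (1 - al) * (2 - al) * (law t [:: false; true; false] + law t [:: true; false; true]) +
    (al * (1 - al)) ^+ 2 *
      (law t [:: true; false; true; false] + law t [:: false; true; false; true] -
       law t [:: true; false; false; true] - law t [:: false; true; true; false]).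
Proof.
have h := law_cons t; have h' := law_rcons t.
have e1 := h [:: true]; have f1 := h' [:: true].
have [[e2 e3] e4] := (h [:: true; true], h [:: true; false], h [:: false; true]).
have [[f2 f3] f4] := (h' [:: true; true], h' [:: true; false], h' [:: false; true]).
have [[a1 a2] a3] :=
  (h [:: true; true; false], h [:: true; false; true], h [:: true; false; false]).
have [[a4 a5] a6] :=
  (h [:: false; true; true], h [:: false; true; false], h [:: false; false; true]).
have [[b1 b2] b3] :=
  (h' [:: true; true; false], h' [:: true; false; true], h' [:: true; false; false]).
have [[b4 b5] b6] :=
  (h' [:: false; true; true], h' [:: false; true; false], h' [:: false; false; true]).
rewrite lawS.
rewrite /= in e1 e2 e3 e4 f1 f2 f3 f4 a1 a2 a3 a4 a5 a6 b1 b2 b3 b4 b5 b6 *.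
(* Consistency reduces every nonconstant word of four letters to RB, BRB, RBR, RBRB, BRBR, RBBR and
   BRRB; constant words cannot produce an interface. *)
have E1 : law t [:: false; false; true; false] =
  law t [:: false; true; false] - law t [:: true; false; true; false] by lra.
have E2 : law t [:: false; true; false; false] =
  law t [:: false; true; false] - law t [:: false; true; false; true] by lra.
have E3 : law t [:: true; true; false; true] =
  law t [:: true; false; true] - law t [:: false; true; false; true] by lra.
have E4 : law t [:: true; false; true; true] =
  law t [:: true; false; true] - law t [:: true; false; true; false] by lra.
have E5 : law t [:: true; true; false; false] =
  law t [:: true; false] - law t [:: false; true; false]
  - law t [:: true; false; true] + law t [:: false; true; false; true] by lra.
have E6 : law t [:: true; true; true; false] =
  law t [:: true; false] - law t [:: false; true; false]
  - law t [:: false; true; true; false] by lra.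
have E7 : law t [:: false; true; true; true] =
  law t [:: true; false] - law t [:: false; true; false]
  - law t [:: false; true; true; false] by lra.
have E8 : law t [:: true; false; false; false] =
  law t [:: true; false] - law t [:: true; false; true]
  - law t [:: true; false; false; true] by lra.
have E9 : law t [:: false; false; false; true] =
  law t [:: true; false] - law t [:: true; false; true]
  - law t [:: true; false; false; true] by lra.
have E10 : law t [:: false; false; true; true] =
  law t [:: true; false] - law t [:: true; false; true]
  - law t [:: false; true; false] + law t [:: true; false; true; false] by lra.
clear -E1 E2 E3 E4 E5 E6 E7 E8 E9 E10.
rewrite E1 E2 E3 E4 E5 E6 E7 E8 E9 E10.
ring.
Qed.

(** * Lost interfaces control the drift of the red density *)

Hypothesis al01 : 0 < al < 1.
Hypothesis p01 : 0 <= p <= 1.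

Lemma law_ge0 t w : 0 <= law t w.
Proof.
elim: t w => [|t IHt] w; first exact: bern_ge0.
rewrite lawS; apply: wsum_ge0 => v _; apply: wsum_ge0 => c _.
by rewrite !mulr_ge0// bern_ge0// lt01W.
Qed.

Lemma law_cons_le t b w : law t (b :: w) <= law t w.
Proof.
rewrite (law_cons _ w).
by case: b; rewrite ?lerDl ?lerDr law_ge0.
Qed.

Lemma law_rcons_le t b w : law t (rcons w b) <= law t w.
Proof.
rewrite (law_rcons _ w).
by case: b; rewrite ?lerDl ?lerDr law_ge0.
Qed.

Definition singletons t := law t [:: false; true; false] + law t [:: true; false; true].

Lemma singletons_ge0 t : 0 <= singletons t.
Proof. by rewrite addr_ge0 ?law_ge0. Qed.

(** As RBRB and BRBR are at most RBR and BRB, the quadratic terms of [law_RB_succ] restore at most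
    [(al * (1 - al)) ^+ 2] times [singletons t], and [2 - al] exceeds [1 + (1 - al) ^+ 2] by
    [al * (1 - al)]. *)
Lemma law_RB_drop t :
  al * (1 - al) * (1 + (1 - al) ^+ 2) * singletons t <=
  law t [:: true; false] - law t.+1 [:: true; false].
Proof.
rewrite law_RB_succ.
have h1 : law t [:: true; false; true; false] <= law t [:: true; false; true].
  exact: (law_rcons_le t false [:: true; false; true]).
have h2 : law t [:: false; true; false; true] <= law t [:: false; true; false].
  exact: (law_rcons_le t true [:: false; true; false]).
have h3 := law_ge0 t [:: true; false; false; true].
have h4 := law_ge0 t [:: false; true; true; false].
rewrite /singletons.
set q := al * (1 - al).
have -> : q * (2 - al) = q * (1 + (1 - al) ^+ 2) + q ^+ 2 by rewrite /q; ring.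
have := sqr_ge0 q; nra.
Qed.

Lemma law_RB_decr s t : (s <= t)%N -> law t [:: true; false] <= law s [:: true; false].
Proof.
move=> /subnK <-; elim: (t - s)%N => [|k IHk]; first by rewrite add0n.
rewrite addSn (le_trans _ IHk)// -subr_ge0 (le_trans _ (law_RB_drop _))//.
have /andP[a0 a1] := al01.
by rewrite !mulr_ge0 ?singletons_ge0 ?subr_ge0 ?addr_ge0 ?sqr_ge0 ?ltW.
Qed.

(** Quotient of the coefficients in [law_red_succ] and [law_RB_drop]: the drift of the red density
    per unit of lost interface density. *)
Definition kappa : R := al / (1 + (1 - al) ^+ 2).

Lemma kappa_gt0 : 0 < kappa.
Proof.
have /andP[a0 a1] := al01; rewrite divr_gt0//.
by rewrite ltr_wpDr ?sqr_ge0.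
Qed.

Lemma kappa_lt1 : kappa < 1.
Proof.
have /andP[a0 a1] := al01.
by rewrite ltr_pdivrMr ?mul1r ?ltr_wpDr ?sqr_ge0//; nra.
Qed.

Lemma law_red_step t : `|law t.+1 [:: true] - law t [:: true]| <=
  kappa * (law t [:: true; false] - law t.+1 [:: true; false]).
Proof.
have /andP[a0 a1] := al01.
apply: (@le_trans _ _ (al ^+ 2 * (1 - al) * singletons t)); last first.
  apply: (@le_trans _ _ (kappa * (al * (1 - al) * (1 + (1 - al) ^+ 2) * singletons t))).
    have u0 : 1 + (1 - al) ^+ 2 != 0 by rewrite lt0r_neq0// ltr_wpDr ?sqr_ge0.
    rewrite le_eqVlt; apply/orP; left; apply/eqP; rewrite /kappa; field.
    exact: u0.
  by rewrite ler_pM2l ?kappa_gt0// law_RB_drop.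
rewrite law_red_succ addrAC subrr add0r normrM ger0_norm; last first.
  by rewrite mulr_ge0 ?sqr_ge0 ?subr_ge0 ?ltW.
rewrite ler_wpM2l//; first by rewrite mulr_ge0 ?sqr_ge0 ?subr_ge0 ?ltW.
rewrite (le_trans (ler_normB _ _))// /singletons.
by rewrite !ger0_norm ?law_ge0.
Qed.

Lemma law_red_cauchy s t : (s <= t)%N -> `|law t [:: true] - law s [:: true]| <=
  kappa * (law s [:: true; false] - law t [:: true; false]).
Proof.
move=> /subnK <-; elim: (t - s)%N => [|k IHk].
  by rewrite add0n !subrr normr0 mulr0.
rewrite addSn.
apply: (le_trans (ler_distD (law (k + s) [:: true]) _ _)).
apply: (le_trans (lerD (law_red_step _) IHk)).
by rewrite -mulrDr ler_pM2l ?kappa_gt0//; lra.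
Qed.

Lemma law0_red : law 0 [:: true] = p. Proof. by rewrite law0 /= mulr1. Qed.
Lemma law0_RB : law 0 [:: true; false] = p * (1 - p).
Proof. by rewrite law0 /= mulr1. Qed.

Lemma law_red_dist t : `|law t [:: true] - p| <= kappa * (p * (1 - p)).
Proof.
have := law_red_cauchy (leq0n t); rewrite law0_red law0_RB => /le_trans; apply.
by rewrite ler_pM2l ?kappa_gt0// lerBlDr lerDl law_ge0.
Qed.

Lemma law_red_le t : law t [:: true] <= 2 * p.
Proof.
have /andP[p0 p1] := p01.
have := law_red_dist t; rewrite ler_norml => /andP[_].
have : kappa * (p * (1 - p)) <= 1 * (p * (1 - p)).
  by rewrite ler_wpM2r ?(ltW kappa_lt1)// mulr_ge0// subr_ge0.
nra.
Qed.

(** * Red runs and their lengths *)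

Definition redrun n := rcons (nseq n true) false.

(** With [false] in front the run has exactly this length; without it, the run may extend further to
    the left. *)
Lemma law_redrun t n :
  law t (redrun n.+1) = law t (false :: redrun n.+1) + law t (redrun n.+2).
Proof. by rewrite (law_cons _ (redrun n.+1)) addrC. Qed.

Lemma law_redrun_decr t n : law t (redrun n.+1) <= law t (redrun n).
Proof. exact: (law_cons_le t true). Qed.

Lemma law_nseq_succ t n : law t (nseq n true) - law t (nseq n.+1 true) = law t (redrun n).
Proof.
rewrite (law_rcons _ (nseq n true)) /redrun.
have -> : rcons (nseq n true) true = nseq n.+1 true by elim: n => //= n ->.
by rewrite addrAC subrr add0r.
Qed.

(* The probabilities of [redrun 1], [redrun 2], ... decrease and add up to at
   most that of a single red site. *)
Lemma law_redrun_le t n : n.+1%:R * law t (redrun n.+1) <= law t [:: true].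
Proof.
(* The stronger bound telescopes through [law_nseq_succ]. *)
suff : n.+1%:R * law t (redrun n.+1) <= law t [:: true] - law t (nseq n.+2 true).
  by move=> h; rewrite (le_trans h)// lerBlDr lerDl law_ge0.
elim: n => [|n IHn]; first by rewrite mul1r -law_nseq_succ.
have := law_nseq_succ t n.+2; have := law_redrun_decr t n.+1.
have -> : n.+2%:R = n.+1%:R + 1 :> R by rewrite natr1.
rewrite mulrDl mul1r.
have : n.+1%:R * law t (redrun n.+2) <= n.+1%:R * law t (redrun n.+1).
  by rewrite ler_wpM2l// law_redrun_decr.
lra.
Qed.

(** Interfaces are sorted by the length of the red run that ends there. *)
Lemma law_RB_runs t k : law t [:: true; false] =
  \sum_(j < k) law t (false :: redrun j.+1) + law t (redrun k.+1).
Proof.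
elim: k => [|k IHk]; first by rewrite big_ord0 add0r.
by rewrite big_ord_recr /= -addrA -law_redrun.
Qed.

Lemma word_step_success l cl v x cx :
  word_step (l :: rcons v x) (cl :: rcons (nseq (size v) true) cx) = v.
Proof.
elim: v l cl => [|m v IHv] l cl //=.
have := IHv m true; case: v {IHv} => [|r v] //= ->.
by rewrite /next_colour.
Qed.

(* The left end of the run moves inwards and the right end stays. *)
Lemma law_run_shrink t n :
  al ^+ n.+4 * (1 - al) * law t (false :: redrun n.+2) <=
  law t.+1 (false :: redrun n.+1).
Proof.
have /andP[a0 a1] := al01.
(* The blue site before the run succeeds, the first red site fails and turns blue, and all other
   coins succeed, so nothing else moves. The window has one more site on the right, whose colour [x]
   is summed out by [law_rcons]. *)
pose c := [:: true, false & rcons (nseq n.+2 true) true].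
pose v := false :: redrun n.+2.
have sr : size (redrun n.+1) = n.+2 by rewrite size_rcons size_nseq.
have sv : size v = n.+4 by rewrite /= size_rcons size_nseq.
have sc : size c = n.+1.+4 by rewrite /= size_rcons size_nseq.
have bc : bern al c = al ^+ n.+4 * (1 - al).
  have bn k : bern al (nseq k true) = al ^+ k.
    by elim: k => //= k ->; rewrite exprS.
  transitivity (al * ((1 - al) * bern al (rcons (nseq n.+2 true) true))) => //.
  by rewrite bern_rcons bn 2![in RHS]exprS; ring.
have step x : word_step (rcons v x) c = false :: redrun n.+1.
  have := word_step_success true false (redrun n.+1) x true; rewrite sr.
  by move=> h; rewrite -[in RHS]h.
rewrite lawS; set u := false :: redrun n.+1.
have -> : (size u).+2 = n.+1.+4 by rewrite (_ : size u = (size (redrun n.+1)).+1) // sr.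
rewrite wsum_rcons.
have pos (v' c' : seq bool) : 0 <= bern al c' * law t v' * (word_step v' c' == u)%:R.
  by rewrite !mulr_ge0 ?law_ge0 ?bern_ge0 ?lt01W.
have posw v' : 0 <= wsum n.+1.+4 (fun c' => bern al c' * law t v' * (word_step v' c' == u)%:R).
  exact: wsum_ge0.
apply: le_trans (wsum_ge (w := v) _ sv); last by move=> v' _; rewrite addr_ge0.
have ge x : bern al c * law t (rcons v x) <= wsum n.+1.+4
    (fun c' => bern al c' * law t (rcons v x) * (word_step (rcons v x) c' == u)%:R).
  apply: le_trans (wsum_ge (w := c) _ sc); last by [].
  by rewrite step eqxx mulr1.
by rewrite -bc (law_rcons _ v) mulrDr lerD// ge.
Qed.

(** * Light cones and rare red sites *)

Definition law_pred t n (phi : pred (seq bool)) : R :=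
  wsum n (fun w => law t w * (phi w)%:R).

(** The property passes back from the new word to the colours that produced it, whatever the coins,
    whose weights then sum to 1. *)
Lemma law_pred_succ t n (phi : pred (seq bool)) :
  (forall v c, phi (word_step v c) -> phi v) ->
  law_pred t.+1 n phi <= law_pred t n.+2 phi.
Proof.
move=> phi_step; rewrite /law_pred.
have -> : wsum n (fun w => law t.+1 w * (phi w)%:R) =
    wsum n.+2 (fun v => wsum n.+2 (fun c =>
      bern al c * law t v * (phi (word_step v c))%:R)).
  under eq_wsum => w sw do rewrite lawS sw -wsumMr.
  rewrite [LHS]exchange_wsum.
apply: eq_wsum => v sv.
  under eq_wsum => w sw do rewrite -wsumMr.
  rewrite [LHS]exchange_wsum; apply: eq_wsum => c sc.
  transitivity (wsum n (fun w =>
      bern al c * law t v * ((word_step v c == w)%:R * (phi w)%:R))).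
    by apply: eq_wsum => w _; rewrite mulrA.
  rewrite wsumMl.
  rewrite (wsum_pick (fun w => (phi w)%:R))//.
  exact: size_word_step sv sc.
apply: ler_wsum => v _.
apply: (@le_trans _ _ (wsum n.+2 (fun c => bern al c * (law t v * (phi v)%:R)))).
  apply: ler_wsum => c _; rewrite -mulrA ler_wpM2l ?bern_ge0 ?lt01W//.
  rewrite ler_wpM2l ?law_ge0// ler_nat.
  by case e: (phi (word_step v c)) => //; rewrite (phi_step _ _ e).
by rewrite wsumMr wsum_bern mul1r.
Qed.

Lemma law_pred_le0 t n (phi : pred (seq bool)) :
  (forall v c, phi (word_step v c) -> phi v) ->
  law_pred t n phi <= law_pred 0 (n + t.*2) phi.
Proof.
move=> phi_step; elim: t n => [|t IHt] n; first by rewrite addn0.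
rewrite (le_trans (law_pred_succ _ _ phi_step))// (le_trans (IHt _))//.
by rewrite doubleS !addnS !addSn.
Qed.

Lemma law_pred0_red n :
  law_pred 0 n (fun w => (0 < count id w)%N) <= n%:R * p.
Proof.
have /andP[p0 p1] := p01.
rewrite /law_pred; elim: n => [|n IHn]; first by rewrite /= mulr0 mul0r.
rewrite wsumS.
under eq_wsum => w _ do rewrite law0 /= mulr1.
under [X in _ + X]eq_wsum => w _ do rewrite law0 /= add0n -mulrA -(law0 al).
rewrite !wsumMl wsum_bern mulr1.
set h := wsum n _ in IHn *.
have h0 : 0 <= h by apply: wsum_ge0 => w _; rewrite mulr_ge0 ?law_ge0.
have -> : n.+1%:R = n%:R + 1 :> R by rewrite natr1.
nra.
Qed.

(** Split on the first letter: after a red one [law_pred0_red] bounds the chance of another, after a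
    blue one the induction applies. *)
Lemma law_pred0_red2 n :
  law_pred 0 n (fun w => (1 < count id w)%N) <= n%:R ^+ 2 * p ^+ 2.
Proof.
have /andP[p0 p1] := p01.
rewrite /law_pred; elim: n => [|n IHn]; first by rewrite /= mulr0 expr0n mul0r.
have := law_pred0_red n; rewrite /law_pred.
rewrite wsumS.
under [X in _ -> X + _ <= _]eq_wsum => w _ do rewrite law0 /= add1n ltnS -mulrA -(law0 al).
under [X in _ -> _ + X <= _]eq_wsum => w _ do rewrite law0 /= add0n -mulrA -(law0 al).
rewrite !wsumMl.
set g := wsum n _ in IHn *.
set h := wsum n _ => hn.
have g0 : 0 <= g by apply: wsum_ge0 => w _; rewrite mulr_ge0 ?law_ge0.
have -> : n.+1%:R = n%:R + 1 :> R by rewrite natr1.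
have n0 : 0 <= n%:R :> R by [].
have : p * h <= n%:R * p ^+ 2 by rewrite expr2 mulrCA ler_wpM2l// mulrC.
have : 0 <= p * g by rewrite mulr_ge0.
have : 0 <= n%:R * p ^+ 2 by rewrite mulr_ge0 ?sqr_ge0.
have := sqr_ge0 p.
move: IHn; nra.
Qed.

(* RBR at time [t] requires two red sites in its light cone at time 0. *)
Lemma law_RBR_le t : law t [:: true; false; true] <= (t.*2 + 3)%:R ^+ 2 * p ^+ 2.
Proof.
pose phi := subseq (alternate true 3).
have phi_step v c : phi (word_step v c) -> phi v by exact: subseq_alternate_step.
apply: (@le_trans _ _ (law_pred t 3 phi)).
  rewrite -[leLHS]mulr1.
  by apply: (wsum_ge (w := [:: true; false; true])) => // v _; rewrite mulr_ge0 ?law_ge0.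
rewrite (le_trans (law_pred_le0 _ _ phi_step))// addnC.
apply: le_trans (law_pred0_red2 _); apply: ler_wsum => w _.
rewrite ler_wpM2l ?law_ge0// ler_nat.
by case e: (phi w) => //; have := leq_count_subseq id e; case: (count _ w) => [|[|?]].
Qed.

Lemma law_red_sum t : law t [:: true] = p + al ^+ 2 * (1 - al) *
  \sum_(s < t) (law s [:: false; true; false] - law s [:: true; false; true]).
Proof.
elim: t => [|t IHt]; first by rewrite big_ord0 law0_red mulr0 addr0.
by rewrite law_red_succ {1}IHt big_ord_recr /= [in RHS]mulrDr addrA.
Qed.

(** Union bound over the place of the first red-blue interface to the right of a red site. *)
Lemma law_nseq_red t n :
  law t [:: true] - n%:R * law t [:: true; false] <= law t (nseq n.+1 true).
Proof.
elim: n => [|n IHn]; first by rewrite mul0r subr0.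
have := law_nseq_succ t n.+1.
have : law t (redrun n.+1) <= law t [:: true; false].
  elim: n {IHn} => // n; apply: le_trans; exact: law_redrun_decr.
have -> : n.+1%:R = n%:R + 1 :> R by rewrite natr1.
move: IHn; lra.
Qed.

End Law.

(** * Colour symmetry and estimates uniform in the initial density *)

Lemma lawN (R : realFieldType) (al p : R) t w :
  law al p t (map negb w) = law al (1 - p) t w.
Proof.
elim: t w => [|t IHt] w; first by rewrite !law0 bernN.
rewrite !lawS size_map -[LHS]wsumN; apply: eq_wsum => v _; apply: eq_wsum => c _.
by rewrite IHt word_stepN (inj_eq (inj_map negb_inj)).
Qed.

Lemma law_blue (R : realFieldType) (al p : R) t :
  law al p t [:: false] = 1 - law al p t [:: true].
Proof. by have := law_cons al p t [::]; rewrite law_nil; lra. Qed.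

Lemma law_red_symm (R : realFieldType) (al p : R) t :
  law al (1 - p) t [:: true] = 1 - law al p t [:: true].
Proof. by rewrite -lawN law_blue. Qed.

(* Singletons are summable in time since each of them has a fixed chance to
   destroy two interfaces; shrinking propagates this to longer runs. *)
Lemma sum_law_run (R : realFieldType) (al : R) n : 0 < al < 1 ->
  exists K : R, forall p N, 0 <= p <= 1 ->
    \sum_(t < N) law al p t (false :: redrun n.+1) <= K * p.
Proof.
move=> al01; have /andP[a0 a1] := al01.
elim: n => [|n [K IHn]].
  pose d := al * (1 - al) * (1 + (1 - al) ^+ 2).
  have d0 : 0 < d.
    by rewrite !mulr_gt0 ?subr_gt0// ltr_wpDr ?sqr_ge0.
  exists d^-1 => p N p01; have /andP[p0 p1] := p01.
  rewrite -ler_pdivrMl ?invr_gt0// invrK.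
  suff : d * \sum_(t < N) law al p t [:: false; true; false] <=
      law al p 0 [:: true; false] - law al p N [:: true; false].
    move=> /le_trans; apply; rewrite law0_RB.
    have := law_ge0 al01 p01 N [:: true; false]; nra.
  elim: N => [|N IHN]; first by rewrite big_ord0 mulr0 subrr.
  rewrite big_ord_recr /= mulrDr.
  have := law_RB_drop al01 p01 N; rewrite -/d /singletons mulrDr.
  have : 0 <= d * law al p N [:: true; false; true].
    by rewrite mulr_ge0 ?(ltW d0) ?law_ge0.
  move: IHN; lra.
pose d := al ^+ n.+4 * (1 - al).
have d0 : 0 < d by rewrite mulr_gt0 ?exprn_gt0 ?subr_gt0.
exists (d^-1 * K) => p N p01.
rewrite -mulrA -ler_pdivrMl ?invr_gt0// invrK.
(* One more time is needed because a run at time [t] is charged to a shorter run at time [t + 1];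
   the term at time 0 is dropped. *)
apply: le_trans (IHn p N.+1 p01).
rewrite big_ord_recl /= mulr_sumr -[leLHS]add0r lerD ?law_ge0//.
by apply: ler_sum => i _; apply: law_run_shrink.
Qed.

(* Since the flux decreases in time it suffices to bound its time average:
   runs longer than [k] contribute at most [2 p / (k + 1)] at each time, the
   shorter ones a bounded total. *)
Lemma law_RB_uniform (R : archiRealFieldType) (al e : R) : 0 < al < 1 -> 0 < e ->
  exists N, forall p t, 0 <= p <= 1 -> (N <= t)%N -> law al p t [:: true; false] <= e * p.
Proof.
move=> al01 e0; have /andP[a0 a1] := al01.
have [k hk] : exists k, 2 / k.+1%:R <= e / 2 :> R.
  exists (Num.truncn (4 / e)).
  have := truncnS_gt (4 / e).
  rewrite ltr_pdivrMr// => h; rewrite ler_pdivrMr// ; nra.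
have [K hK] : exists K : R, forall p N, 0 <= p <= 1 ->
    \sum_(t < N) \sum_(j < k) law al p t (false :: redrun j.+1) <= K * p.
  elim: k {hk} => [|k [K1 h1]].
    exists 0 => p N _; rewrite mul0r big1// => i _; exact: big_ord0.
  have [K2 h2] := sum_law_run k al01.
  exists (K1 + K2) => p N p01; rewrite (eq_bigr _ (fun i _ => big_ord_recr _ _)) /=.
  by rewrite big_split /= mulrDl lerD// ?h1 ?h2.
(* The choice of [k] makes long runs cost half of [e]; once [t >= 2 * K' / e], the time average of
   the short runs costs at most the other half. *)
pose K' := Num.max 0 K.
exists (Num.truncn (2 * K' / e)).+1 => p t p01 le_t.
have /andP[p0 p1] := p01.
have K'0 : 0 <= K' by rewrite le_max lexx.
have t0 : 0 < t%:R :> R by rewrite ltr0n (leq_trans _ le_t).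
rewrite -(ler_pM2l t0).
apply: (@le_trans _ _ (\sum_(s < t) law al p s [:: true; false])).
  rewrite mulr_natl -[X in _ *+ X]card_ord -sumr_const.
  by apply: ler_sum => i _; apply: law_RB_decr => //; apply: ltnW.
rewrite (eq_bigr (fun s : 'I_t => \sum_(j < k) law al p s (false :: redrun j.+1) +
  law al p s (redrun k.+1))) => [|i _]; last exact: law_RB_runs.
rewrite big_split /=.
have h1 : \sum_(s < t) \sum_(j < k) law al p s (false :: redrun j.+1) <= K' * p.
  by rewrite (le_trans (hK p t p01))// ler_wpM2r// le_max lexx orbT.
have h2 : \sum_(s < t) law al p s (redrun k.+1) <= t%:R * (e / 2 * p).
  rewrite mulr_natl -[X in _ *+ X]card_ord -sumr_const.
  apply: ler_sum => i _.
  apply: (@le_trans _ _ (2 / k.+1%:R * p)); last by rewrite ler_wpM2r.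
  rewrite mulrAC ler_pdivlMr// mulrC.
  by rewrite (le_trans (law_redrun_le al01 p01 i k))// law_red_le.
apply: (le_trans (lerD h1 h2)).
have h3 : 2 * K' / e <= t%:R.
  by rewrite (le_trans (ltW (truncnS_gt _)))// ler_nat.
have h4 : K' * p <= t%:R * (e / 2) * p.
  by rewrite ler_wpM2r//; move: h3; rewrite ler_pdivrMr//; lra.
move: h4; lra.
Qed.

Lemma law_nseq_blue (R : realFieldType) (al p : R) t n : 0 < al < 1 -> 0 <= p <= 1 ->
  1 - law al p t [:: true] - n%:R * law al p t [:: true; false] <=
  law al p t (nseq n.+1 false).
Proof.
move=> al01 p01.
have p01' : 0 <= 1 - p <= 1 by move: p01; lra.
have := law_nseq_red al01 p01' t n.
rewrite law_red_symm -!lawN /= -law_RB_BR map_nseq.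
exact.
Qed.

(** Up to time [N + 1] the density gains at least [b * p / 2]; afterwards it moves by at most
    [b * p / 4], as few interfaces are left. *)
Lemma law_red_gain (R : archiRealFieldType) (al : R) : 0 < al < 1 ->
  exists2 e : R, 0 < e & forall p, 0 < p < e ->
    exists2 h : R, 0 < h & exists N, forall t, (N <= t)%N -> p + h <= law al p t [:: true].
Proof.
move=> al01; have /andP[a0 a1] := al01.
pose b := al ^+ 2 * (1 - al).
have b0 : 0 < b by rewrite mulr_gt0 ?exprn_gt0 ?subr_gt0.
have [N hN] := law_RB_uniform al01 (divr_gt0 b0 (ltr0n R 4)).
pose C : R := \sum_(s < N.+1) (s.*2 + 3)%:R ^+ 2.
have C0 : 0 <= C by apply: sumr_ge0 => i _; rewrite sqr_ge0.
have C2 : 0 < 2 * (C + 2) by rewrite mulr_gt0// ltr_wpDl.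
(* Since [(1 - p) ^+ 2 - C * p >= 1 - (C + 2) * p], this threshold keeps the left side above 1/2. *)
exists (2 * (C + 2))^-1; first by rewrite invr_gt0.
move=> p /andP[p0 pe].
have hp : 2 * (C + 2) * p < 1 by rewrite mulrC -ltr_pdivlMr// mul1r.
have p01 : 0 <= p <= 1 by rewrite ltW//=; nra.
exists (b * p / 4); first by rewrite divr_gt0 ?(mulr_gt0 b0 p0).
exists N.+1 => t Nt.
have h1 := law_red_cauchy al01 p01 Nt.
have h2 : kappa al * (law al p N.+1 [:: true; false] - law al p t [:: true; false])
    <= b / 4 * p.
  rewrite (le_trans _ (hN p N.+1 p01 (leqnSn N)))//.
  have := law_ge0 al01 p01 t [:: true; false].
  have := law_ge0 al01 p01 N.+1 [:: true; false].
  have := kappa_lt1 al01; have := kappa_gt0 al01; nra.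
have h3 := law_red_sum al p N.+1; rewrite -/b in h3.
(* Of the BRB terms only the one at time 0 is kept. *)
have h4 : p * (1 - p) ^+ 2 - C * p ^+ 2 <= \sum_(s < N.+1)
    (law al p s [:: false; true; false] - law al p s [:: true; false; true]).
  rewrite sumrB lerB//.
    rewrite big_ord_recl /= law0 /= mulr1.
    rewrite (_ : (1 - p) * (p * (1 - p)) = p * (1 - p) ^+ 2); last by ring.
    by rewrite lerDl sumr_ge0// => i _; rewrite law_ge0.
  by rewrite mulr_suml; apply: ler_sum => i _; apply: law_RBR_le.
have h5 : b * (p * (1 - p) ^+ 2 - C * p ^+ 2) <= b * \sum_(s < N.+1)
    (law al p s [:: false; true; false] - law al p s [:: true; false; true]).
  by rewrite ler_pM2l.
have h6 : p / 2 <= p * (1 - p) ^+ 2 - C * p ^+ 2.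
  rewrite (_ : _ - _ = p * ((1 - p) ^+ 2 - C * p)); last by ring.
  rewrite ler_pM2l//; have := sqr_ge0 p; move: hp; lra.
have h7 : b * (p / 2) <= b * (p * (1 - p) ^+ 2 - C * p ^+ 2) by rewrite ler_pM2l.
move: h1; rewrite ler_norml => /andP[h1 _].
move: h1 h2 h3 h5 h7; lra.
Qed.

(** * Law of the process on finite windows *)

(** Suppose the coin of the centre fails. A single opposite neighbour that succeeds has proportion 1
    against at most 1/2; two opposite neighbours face a lone centre with proportion 0, so one
    success among them wins. *)
Lemma chameleon_stepE (C : bool -> int -> bool) (x : config) i :
  chameleon_step C x i =
  next_colour (x (i - 1)) (x i) (x (i + 1))
    (C (x (i - 1)) (i - 1)) (C (x i) i) (C (x (i + 1)) (i + 1)).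
Proof.
rewrite /chameleon_step /proportion /next_colour /=.
case: (x (i - 1)); case: (x i); case: (x (i + 1)) => /=;
  by repeat match goal with |- context [C ?c ?j] => case: (C c j) end.
Qed.

Fixpoint sites (i : int) n : seq int :=
  if n is n'.+1 then i :: sites (i + 1) n' else [::].

Lemma size_sites i n : size (sites i n) = n.
Proof. by elim: n i => //= n IHn i; rewrite IHn. Qed.

Lemma window_step (C : bool -> int -> bool) (x : config) i n :
  [seq chameleon_step C x j | j <- sites (i + 1) n] =
  word_step [seq x j | j <- sites i n.+2] [seq C (x j) j | j <- sites i n.+2].
Proof.
elim: n i => // n IHn i.
by rewrite /= IHn /= chameleon_stepE addrK.
Qed.

Lemma measurable_map_eq d (T : measurableType d) (I : Type) (f : I -> T -> bool)
    (s : seq I) v : (forall i, measurable_fun setT (f i)) ->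
  measurable [set w | [seq f i w | i <- s] == v].
Proof.
move=> mf; elim: s v => [|i s IHs] [|b v].
- by rewrite (_ : [set _ | _] = setT)//; apply/seteqP; split.
- by rewrite (_ : [set _ | _] = set0)//; apply/seteqP; split.
- by rewrite (_ : [set _ | _] = set0)//; apply/seteqP; split.
rewrite (_ : [set w | _] = f i @^-1` [set b] `&` [set w | [seq f i w | i <- s] == v]).
  by apply: measurableI => //; rewrite -[X in measurable X]setTI; apply: mf.
apply/seteqP; split=> w /=; first by rewrite eqseq_cons => /andP[/eqP ? ?].
by move=> [<- /eqP ->]; rewrite eqxx.
Qed.

Section Prob.
Context d (T : measurableType d) (R : realType) (P : probability T R).

Definition prob (E : set T) : R := fine (P E).

Lemma probK E : measurable E -> P E = (prob E)%:E.
Proof. by move=> mE; rewrite fineK// fin_num_measure. Qed.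

Lemma prob_split (I : Type) (f : I -> T -> bool) (s : seq I) (E : set T) :
  measurable E -> (forall i, measurable_fun setT (f i)) ->
  prob E = wsum (size s) (fun v => prob (E `&` [set w | [seq f i w | i <- s] == v])).
Proof.
move=> + mf; elim: s E => [|i s IHs] E mE.
  by rewrite /= (_ : [set _ | _] = setT) ?setIT//; apply/seteqP; split.
have mgE b : measurable (E `&` f i @^-1` [set b]).
  by apply: measurableI => //; rewrite -[X in measurable X]setTI; apply: mf.
have -> : prob E = prob (E `&` f i @^-1` [set true]) + prob (E `&` f i @^-1` [set false]).
  rewrite /prob -fineD ?fin_num_measure//; congr fine.
  rewrite -measureU//; last first.
    by apply/seteqP; split=> w //= [[_ ->] [_]].
  congr (P _); apply/seteqP; split=> w /=; last by case=> [[]|[]].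
  by move=> Ew; case: (f i w); [left|right].
rewrite !IHs//.
congr (_ + _); apply: eq_wsum => v _; congr prob; apply/seteqP; split=> w /=.
- by move=> [[Ew ->] /eqP ->]; rewrite eqxx.
- by rewrite eqseq_cons => -[Ew /andP[/eqP -> ->]].
- by move=> [[Ew ->] /eqP ->]; rewrite eqxx.
- by rewrite eqseq_cons => -[Ew /andP[/eqP -> ->]].
Qed.

Lemma mutually_independent_bool (I : eqType) (X : I -> {RV P >-> bool})
    (L : seq (I * bool)) : mutually_independent X -> uniq (unzip1 L) ->
  P [set w | all (fun k => X k.1 w == k.2) L] =
  (\prod_(k <- L) P [set w | X k.1 w == k.2])%E.
Proof.
move=> iX uL.
(* Independence asks for a set at every index: the prescribed value is looked up in [L], with a
   dummy value outside. *)
pose A i := [set nth false (unzip2 L) (index i (unzip1 L))].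
have AL k : k \in L -> A k.1 = [set k.2].
  move=> kL; rewrite /A; congr [set _].
  have kL' := kL; rewrite -index_mem in kL.
  rewrite -[k in k.1](nth_index k kL') -(nth_map k k.1 fst)//.
  rewrite index_uniq ?size_map// (nth_map k)// nth_index//.
have := iX (unzip1 L) A uL (fun _ => Logic.I).
rewrite big_map => e.
transitivity (P (\bigcap_(i in [set` unzip1 L]) X i @^-1` A i)).
  congr (P _); apply/seteqP; split=> w /=.
    move=> /allP h i /= /mapP[k kL ->]; rewrite (AL k kL) /=; exact/eqP/h.
  move=> h; apply/allP => k kL; apply/eqP.
  have : [set` unzip1 L] k.1 by apply: map_f.
  by move=> /h; rewrite (AL k kL).
rewrite e big_seq [RHS]big_seq; apply: eq_bigr => k kL; congr (P _).
by rewrite (AL k kL); apply/seteqP; split=> w /= /eqP.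
Qed.

End Prob.

Lemma bernoulli_prob1 (R : realType) (p : R) b : 0 <= p <= 1 ->
  bernoulli_prob p [set b] = (if b then p else 1 - p)%:E.
Proof. by move=> p01; rewrite /bernoulli_prob p01 fsbig_set1. Qed.

Section Window.
Context d (T : measurableType d) (R : realType) (P : probability T R).
Variables (al p : R) (coin : bool -> int -> nat -> {RV P >-> bool}).
Variable xi0 : int -> {RV P >-> bool}.
Hypothesis al01 : 0 <= al <= 1.
Hypothesis p01 : 0 <= p <= 1.
Hypothesis rnd : chameleon_randomness al p coin xi0.

Local Notation key := (bool * int * nat)%type.

Definition coins_are (K : seq (key * bool)) w :=
  all (fun k => coin k.1.1.1 k.1.1.2 k.1.2 w == k.2) K.

Definition window t i (v : seq bool) w :=
  [seq chameleon_process coin xi0 t w j | j <- sites i (size v)] == v.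

Lemma measurable_coins_are K : measurable [set w | coins_are K w].
Proof.
rewrite (_ : [set w | _] = [set w | [seq (fun (k : key * bool) w =>
    coin k.1.1.1 k.1.1.2 k.1.2 w) k w | k <- K] == unzip2 K]).
  exact: measurable_map_eq.
apply/funext => w /=; congr is_true.
by elim: K => //= k K IHK; rewrite eqseq_cons IHK.
Qed.

Lemma measurable_site t j : measurable_fun setT (fun w => chameleon_process coin xi0 t w j).
Proof.
elim: t j => [|t IH] j; first exact: measurable_funPT.
apply: (@measurable_chameleon_step _ _ (fun c j w => coin c j t w)) => // c k.
Qed.

Lemma measurable_window t i v : measurable [set w | window t i v w].
Proof.
apply: (measurable_map_eq (f := fun j w => chameleon_process coin xi0 t w j)).
exact: measurable_site.
Qed.

Lemma prob_coin c i t b :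
  P [set w | coin c i t w == b] = (if b then al else 1 - al)%:E.
Proof.
have [_ h _] := rnd; rewrite -bernoulli_prob1// -(h c i t) /distribution /pushforward.
by congr (P _); apply/seteqP; split=> w /= /eqP.
Qed.

Lemma prob_xi0 i b : P [set w | xi0 i w == b] = (if b then p else 1 - p)%:E.
Proof.
have [_ _ h] := rnd; rewrite -bernoulli_prob1// -(h i) /distribution /pushforward.
by congr (P _); apply/seteqP; split=> w /= /eqP.
Qed.

Lemma prod_bern (a : R) (L : seq bool) :
  (\prod_(b <- L) (if b then a else 1 - a)%:E)%E = (bern a L)%:E.
Proof. by elim: L => [|b L IHL]; rewrite ?big_nil// big_cons IHL EFinM. Qed.

Lemma uniq_sites i n : uniq (sites i n).
Proof.
have ge j m k : k \in sites j m -> j <= k.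
  by elim: m j => //= m IHm j; rewrite inE => /orP[/eqP ->//|/IHm]; lia.
by elim: n i => //= n IHn i; rewrite IHn andbT; apply/negP => /ge; lia.
Qed.

Lemma prob_window0 i v K : uniq (unzip1 K) ->
  prob P [set w | window 0 i v w && coins_are K w] =
  law al p 0 v * bern al (unzip2 K).
Proof.
move=> uK; have [ind _ _] := rnd.
pose L := [seq (inr jb.1, jb.2) | jb <- zip (sites i (size v)) v] ++
  [seq (inl kb.1, kb.2) | kb <- K] : seq (((bool * int * nat) + int) * bool).
have uL : uniq (unzip1 L).
  rewrite /unzip1 map_cat cat_uniq -!map_comp; apply/and3P; split.
  - rewrite (map_comp (inr : int -> key + int) fst) map_inj_uniq; last by move=> ? ? [].
    by rewrite -/unzip1 unzip1_zip ?uniq_sites ?size_sites.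
  - by apply/hasPn => _ /mapP[k _ ->]; apply/negP => /mapP[].
  - by rewrite (map_comp (inl : key -> key + int) fst) map_inj_uniq// => ? ? [].
rewrite /prob (_ : [set w | _] = [set w | all (fun k => randomness coin xi0 k.1 w == k.2) L]).
  rewrite mutually_independent_bool// big_cat /= !big_map.
  rewrite (eq_bigr (fun jb : int * bool => (if jb.2 then p else 1 - p)%:E)); last first.
    by move=> jb _; rewrite prob_xi0.
  rewrite [X in (_ * X)%E](eq_bigr
    (fun jb : key * bool => (if jb.2 then al else 1 - al)%:E)); last first.
    by move=> [[[c j] t] b] _; rewrite prob_coin.
  rewrite -(big_map snd xpredT (fun b => (if b then p else 1 - p)%:E)).
  rewrite -(big_map snd xpredT (fun b => (if b then al else 1 - al)%:E)).
  by rewrite !prod_bern -/unzip2 unzip2_zip ?size_sites// law0.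
apply/funext => w /=; congr is_true; rewrite all_cat !all_map; congr (_ && _).
  rewrite /window; elim: v {L uL} i => //= b v IHv i.
  by rewrite eqseq_cons IHv.
by apply: eq_all => -[[[c j] t] b].
Qed.

(* Carrying the coins [K] not used before time [t] makes independence of the
   present and the future part of the induction. *)
Lemma prob_window_coins t i v K : uniq (unzip1 K) ->
  all (fun k => t <= k.1.2)%N K ->
  prob P [set w | window t i v w && coins_are K w] =
  law al p t v * bern al (unzip2 K).
Proof.
elim: t i v K => [|t IHt] i u K uK tK; first exact: prob_window0.
have zip_map (A B : Type) (f : A -> B) s : zip (map f s) s = [seq (f j, j) | j <- s].
  by elim: s => //= j s ->.
set E := [set w | _]; set n := size u; pose s := sites (i - 1) n.+2.
have mE : measurable E.
  rewrite (_ : E = [set w | window t.+1 i u w] `&` [set w | coins_are K w]).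
    by apply: measurableI; [exact: measurable_window | exact: measurable_coins_are].
  by apply/seteqP; split=> w /= /andP.
pose xi := chameleon_process coin xi0 t.
have mxi := measurable_site t.
rewrite (prob_split P s mE mxi) size_sites lawS -wsumMr; apply: eq_wsum => v sv.
have mEv : measurable (E `&` [set w | [seq xi w j | j <- s] == v]).
  by apply: measurableI => //; exact: measurable_map_eq.
pose h (z : bool * int) w := coin z.1 z.2 t w.
have mh z : measurable_fun setT (h z) by exact: measurable_funPT.
rewrite (prob_split P (zip v s) mEv mh) size_zip sv size_sites minnn.
rewrite -wsumMr; apply: eq_wsum => c sc.
(* Once the colours [v] are fixed, the coins used at time [t] have deterministic keys. They can join
   [K], whose keys all carry later times. *)
pose K' := zip [seq (z.1, z.2, t) | z <- zip v s] c ++ K.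
have szs : size c = size [seq (z.1, z.2, t) | z <- zip v s].
  by rewrite size_map size_zip sv size_sites minnn sc.
have uK' : uniq (unzip1 K').
  rewrite /K' /unzip1 map_cat -/(unzip1 _) unzip1_zip ?szs//.
  rewrite cat_uniq -/(unzip1 K) uK andbT; apply/andP; split.
    apply: (@map_uniq _ _ (fun k : key => k.1.2)).
    rewrite -map_comp -/(unzip2 (zip v s)) unzip2_zip ?uniq_sites//.
    by rewrite sv size_sites.
  apply/hasPn => _ /mapP[k kK ->]; apply/negP => /mapP[z _ e].
  by have /allP/(_ _ kK) := tK; rewrite e /= ltnn.
have tK' : all (fun k => t <= k.1.2)%N K'.
  rewrite all_cat; apply/andP; split; last first.
    by apply: sub_all tK => k; apply: ltnW.
  apply/allP => k kz; have : k.1 \in unzip1 (zip [seq (z.1, z.2, t) | z <- zip v s] c).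
    exact: map_f.
  by rewrite unzip1_zip ?szs// => /mapP[z _ ->] /=.
have bK' : bern al (unzip2 K') = bern al c * bern al (unzip2 K).
  rewrite /K' /unzip2 map_cat -/(unzip2 _) unzip2_zip ?szs//.
  by elim: (c) => [|b c' IHc] /=; rewrite ?mul1r// IHc mulrA.
have coinsK' w : coins_are K' w = ([seq h z w | z <- zip v s] == c) && coins_are K w.
  rewrite /coins_are all_cat; congr (_ && _).
  elim: (zip v s) (c) szs => [|z zs IHz] [|b c'] //= [szs].
  by rewrite eqseq_cons IHz.
set F := _ `&` _.
have FE w : F w <-> word_step v c == u /\ window t (i - 1) v w && coins_are K' w.
  have wE : window t (i - 1) v w = ([seq xi w j | j <- s] == v) by rewrite /window sv.
  rewrite coinsK' wE.
  have step : [seq xi w j | j <- s] = v -> [seq h z w | z <- zip v s] = c ->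
      [seq chameleon_process coin xi0 t.+1 w j | j <- sites i (size u)] = word_step v c.
    move=> xv hc; transitivity (word_step [seq xi w j | j <- s]
        [seq coin (xi w j) j t w | j <- s]).
      by have := window_step (fun c j => coin c j t w) (xi w) (i - 1) n; rewrite subrK.
    congr word_step; first exact: xv.
    rewrite -hc -[in RHS]xv zip_map -[RHS]map_comp; exact: eq_map.
  split.
    move=> [[/andP[/eqP eu ->] xv] hc].
    have {}xv : [seq xi w j | j <- s] = v by exact/eqP.
    have {}hc : [seq h z w | z <- zip v s] = c by exact/eqP.
    by rewrite -(step xv hc) eu xv hc !eqxx.
  move=> [e /and3P[/eqP xv /eqP hc cK]]; split; [split|]; [|exact/eqP|exact/eqP].
  by apply/andP; split; rewrite // /window (step xv hc).
case: eqP FE => [_|_] FE; last first.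
  rewrite (_ : F = set0) ?mulr0 ?mul0r /prob ?measure0//.
  by apply/seteqP; split=> w // /FE[].
rewrite (_ : F = [set w | window t (i - 1) v w && coins_are K' w]); last first.
  by apply/seteqP; split=> w /=; [move=> /FE[] | move=> hw; apply/FE].
by rewrite IHt// bK' mulr1; ring.
Qed.

Lemma prob_window t i v :
  P [set w | window t i v w] = (law al p t v)%:E.
Proof.
rewrite probK; [congr EFin|exact: measurable_window].
have := @prob_window_coins t i v [::] isT isT; rewrite mulr1 => <-.
by congr (prob _ _); apply/seteqP; split=> w /=; rewrite andbT.
Qed.
End Window.

(** * Topology and integration on configurations *)

Lemma cvg_config (x_ : nat -> config) (x : config) :
  (forall i, \forall n \near \oo, x_ n i = x i) -> x_ @ \oo --> x.
Proof.
move=> xi; apply/cvg_sup => i U [/= _ [[V /= oV <- /= Vx]]] /filterS; apply.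
have := xi i; apply: filterS => n /= e; by rewrite e.
Qed.

Lemma mem_sites i n j : (j \in sites i n) = (i <= j < i + n%:Z).
Proof. by elim: n i => [|n IHn] i; rewrite ?inE ?IHn; lia. Qed.

Definition box n := sites (- n%:Z) n.*2.+1.

Lemma box_near (x y : nat -> config) : (forall n, {in box n, x n =1 y n}) ->
  forall i, \forall n \near \oo, x n i = y n i.
Proof.
move=> xy i; exists `|i|%N => // n /= ni.
by apply: xy; rewrite /box mem_sites; lia.
Qed.

(** Otherwise configurations agreeing with [x] on ever larger boxes would converge to [x] while
    their images stay away from [f x]. *)
Lemma continuous_box (R : realType) (f : config -> R) (x : config) (e : R) :
  continuous f -> 0 < e ->
  exists n, forall y : config, {in box n, y =1 x} -> `|f x - f y| <= e.
Proof.
move=> cf e0; apply: contrapT => /forallNP h.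
have /choice[y hy] : forall n, exists y : config,
    {in box n, y =1 x} /\ e < `|f x - f y|.
  move=> n; have /existsNP[y /not_implyP[yx fy]] := h n.
  by exists y; split=> //; rewrite ltNge; apply/negP.
have yx : y @ \oo --> x.
  by apply: cvg_config; apply: (box_near (y := fun=> x)) => n; case: (hy n).
have fyx : f (y n) @[n --> \oo] --> f x by apply: continuous_cvg yx; exact: cf.
have /cvgrPdist_le/(_ e e0)[n _ /(_ n (leqnn n))] := fyx.
by case: (hy n) => _; rewrite ltNge => /negP.
Qed.

Lemma measurable_coord i : measurable_fun setT (fun x : config => x i).
Proof.
apply: (measurable_fun_bool true); rewrite setTI.
by apply: sub_sigma_algebra; exists i, true.
Qed.

Definition override (s : seq int) (y x : config) : config :=
  fun j => if j \in s then x j else y j.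

(** Only finitely many Boolean coordinates matter, and they are split off one at a time. *)
Lemma measurable_override (R : realType) (f : config -> R) s y :
  measurable_fun setT (fun x => f (override s y x)).
Proof.
elim: s y => [|i s IHs] y; first exact: (@measurable_cst _ _ _ _ _ (f y)).
pose z b : config := fun j => if j == i then b else y j.
rewrite (_ : (fun x => _) = fun x : config =>
    if x i then f (override s (z true) x) else f (override s (z false) x)).
  by apply: measurable_fun_ifT => //; exact: measurable_coord.
apply/funext => x; rewrite -(fun_if (fun b => f (override s (z b) x))).
congr f; apply/funext => j; rewrite /override /z inE.
have [->|_] /= := eqVneq j i; last by case: ifP.
by case: (x i); case: ifP.
Qed.

(** [f] is the pointwise limit of the functions that read a box and paint the rest blue. *)
Lemma measurable_continuous_config (R : realType) (f : config -> R) :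
  continuous f -> measurable_fun setT f.
Proof.
move=> cf; apply: (measurable_realfun.measurable_fun_cvg
  (h := fun n x => f (override (box n) all_blue x))).
  by move=> n; exact: measurable_override.
move=> x _; apply: continuous_cvg; first exact: cf.
apply: cvg_config; apply: (box_near (y := fun=> x)) => n i.
by rewrite /override => ->.
Qed.

(** * Integrals of functions nearly constant on two events *)

Section IntegralBound.
Context d (T : measurableType d) (R : realType) (mu : probability T R).

Lemma integrable_indic2 (A B : set T) (c a b : R) : measurable A -> measurable B ->
  mu.-integrable setT (EFin \o (fun x => c + a * \1_A x + b * \1_B x)).
Proof.
move=> mA mB.
have ic : mu.-integrable setT (EFin \o cst c) by exact: finite_measure_integrable_cst.
have iZ E (k : R) : measurable E -> mu.-integrable setT (EFin \o (fun x => k * \1_E x)).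
  move=> mE; exact: (integrableZl measurableT k (integrable_indic mu mE)).
exact: (integrableD measurableT (integrableD measurableT ic (iZ A a mA)) (iZ B b mB)).
Qed.

Lemma Rintegral_indic2 (A B : set T) (c a b : R) : measurable A -> measurable B ->
  Rintegral mu setT (fun x => c + a * \1_A x + b * \1_B x) =
  c + a * prob mu A + b * prob mu B.
Proof.
move=> mA mB.
have iA E : measurable E -> mu.-integrable setT (EFin \o \1_E) by exact: integrable_indic.
have iZ E (k : R) : measurable E -> mu.-integrable setT (EFin \o (fun x => k * \1_E x)).
  by move=> mE; exact: (integrableZl measurableT k (iA E mE)).
have ic : mu.-integrable setT (EFin \o cst c) by exact: finite_measure_integrable_cst.
have prE E : measurable E -> Rintegral mu setT \1_E = prob mu E.
  by move=> mE; rewrite /Rintegral integral_indic// setIT.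
rewrite RintegralD//; [|exact: (integrableD measurableT ic (iZ _ _ mA))|exact: iZ].
rewrite RintegralD//; last exact: iZ.
rewrite !RintegralZl//; [|exact: iA|exact: iA].
rewrite !prE// Rintegral_cst//.
have -> : fine (mu setT) = 1 by rewrite (_ : mu setT = 1%E)//; exact: probability_setT.
by rewrite mulr1.
Qed.

(** Compare [f] with the simple function equal to [a] on [A], [b] on [B] and 0 elsewhere: the error
    is at most [e] on both events and [M] off them. *)
Lemma Rintegral_concentrated (f : T -> R) (A B : set T) (a b e M : R) :
  measurable_fun setT f -> (forall x, `|f x| <= M) ->
  measurable A -> measurable B -> A `&` B = set0 -> 0 <= e ->
  (forall x, A x -> `|a - f x| <= e) -> (forall x, B x -> `|b - f x| <= e) ->
  `|Rintegral mu setT f - (a * prob mu A + b * prob mu B)| <=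
  e + M * (1 - prob mu A - prob mu B).
Proof.
move=> mf fM mA mB AB e0 fa fb.
have M0 (x : T) : 0 <= M by rewrite (le_trans _ (fM x)).
have if_ : mu.-integrable setT (EFin \o f).
  apply: measurable_bounded_integrable => //.
    by rewrite (le_lt_trans (probability_le1 _ _))// ltry.
  exists M; split; first exact: num_real.
  by move=> N MN x _ /=; rewrite (le_trans (fM x))// ltW.
have ih := integrable_indic2 0 a b mA mB.
have -> : a * prob mu A + b * prob mu B = 0 + a * prob mu A + b * prob mu B by rewrite add0r.
rewrite -Rintegral_indic2// -RintegralB//.
have igf : mu.-integrable setT (EFin \o (fun x => f x - (0 + a * \1_A x + b * \1_B x))).
  exact: (integrableB measurableT if_ ih).
apply: (le_trans (le_normr_Rintegral _ igf)) => //.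
have -> : e + M * (1 - prob mu A - prob mu B) =
  (e + M) + (- M) * prob mu A + (- M) * prob mu B by ring.
rewrite -Rintegral_indic2//.
apply: le_Rintegral => //.
- exact: (integrable_norm igf).
- exact: integrable_indic2.
move=> x _; rewrite !indicE.
have [xA|xA] := boolP (x \in A); have [xB|xB] := boolP (x \in B).
- have : (A `&` B) x by split; apply: set_mem.
  by rewrite AB.
- rewrite distrC; move: (fa x (set_mem xA)).
  by rewrite /= !(mulr1, mulr0, addr0, add0r) addrK.
- rewrite distrC; move: (fb x (set_mem xB)).
  by rewrite /= !(mulr1, mulr0, addr0, add0r) addrK.
- by rewrite /= !(mulr1, mulr0, addr0, add0r) subr0 (le_trans (fM x))// lerDr.
Qed.

End IntegralBound.

(** * The fixation probability *)

Section Limit.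
Variables (R : realType) (al : R).
Hypothesis al01 : 0 < al < 1.
Local Notation law := (law al).
Local Notation red_density p t := (law p t [:: true]).
Local Notation flux p t := (law p t [:: true; false]).

(* [red_density + kappa * flux] is nonincreasing in time, and the flux vanishes. *)
Definition red_limit (p : R) : R :=
  inf (range (fun t => red_density p t + kappa al * flux p t)).

Lemma red_limit_dist p t : 0 <= p <= 1 ->
  `|red_limit p - red_density p t| <= kappa al * flux p t.
Proof.
move=> p01; have k0 := kappa_gt0 al01.
(* Every lower envelope lies below every upper one, so the infimum is sandwiched between them at
   each time. *)
have low s u : red_density p s - kappa al * flux p s <= red_density p u + kappa al * flux p u.
  have fs := law_ge0 al01 p01 s [:: true; false].
  have fu := law_ge0 al01 p01 u [:: true; false].
  have kfs := mulr_ge0 (ltW k0) fs; have kfu := mulr_ge0 (ltW k0) fu.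
  have [su|us] := leqP s u.
    have := law_red_cauchy al01 p01 su; rewrite ler_norml mulrBr => /andP[]; lra.
  have := law_red_cauchy al01 p01 (ltnW us); rewrite ler_norml mulrBr => /andP[]; lra.
rewrite ler_norml; apply/andP; split.
  rewrite lerBrDl; apply: lb_le_inf; first by
    exists (red_density p 0 + kappa al * flux p 0), 0%N.
  by move=> _ [u _ <-]; exact: low.
rewrite lerBlDl; apply: ge_inf; last by exists t.
by exists (red_density p 0 - kappa al * flux p 0) => _ [u _ <-]; exact: low.
Qed.

Lemma red_limit_near p t : 0 <= p <= 1 -> `|red_limit p - red_density p t| <= flux p t.
Proof.
move=> p01; apply: (le_trans (red_limit_dist _ p01)).
by apply: ler_piMl; [exact: law_ge0 | exact: ltW (kappa_lt1 al01)].
Qed.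

Lemma red_limit_dist0 p : 0 <= p <= 1 ->
  `|red_limit p - p| <= kappa al * (p * (1 - p)).
Proof. by move=> p01; have := red_limit_dist 0 p01; rewrite law0_red law0_RB. Qed.

(** The bounds are [p] minus and plus [p * (1 - p)]; strictness comes from [kappa al < 1]. *)
Lemma red_limit_bounds p : 0 < p < 1 -> p ^+ 2 < red_limit p < 2 * p - p ^+ 2.
Proof.
move=> /andP[p0 p1]; have p01 : 0 <= p <= 1 by rewrite !ltW.
have : kappa al * (p * (1 - p)) < p * (1 - p).
  by rewrite gtr_pMl ?(kappa_lt1 al01)// mulr_gt0 ?subr_gt0.
have := red_limit_dist0 p01; rewrite ler_norml => /andP[h1 h2] h3.
apply/andP; split; lra.
Qed.

Lemma red_limit01 p : 0 <= p <= 1 -> 0 <= red_limit p <= 1.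
Proof.
move=> p01; have /andP[p0 p1] := p01.
have q0 : 0 <= p * (1 - p) by rewrite mulr_ge0 ?subr_ge0.
have : kappa al * (p * (1 - p)) <= p * (1 - p) by rewrite ler_piMl ?(ltW (kappa_lt1 al01)).
have := sqr_ge0 p; have := sqr_ge0 (1 - p).
have := red_limit_dist0 p01; rewrite ler_norml => /andP[h1 h2] h3 h4 h5.
apply/andP; split; lra.
Qed.

Lemma red_limit0 : red_limit 0 = 0.
Proof.
have := red_limit_dist0 (p := 0); rewrite mul0r mulr0 subr0 lexx ler01 => /(_ isT).
by rewrite normr_le0 => /eqP.
Qed.

Lemma red_limit1 : red_limit 1 = 1.
Proof.
have := red_limit_dist0 (p := 1); rewrite subrr !mulr0 lexx ler01 => /(_ isT).
by rewrite normr_le0 subr_eq0 => /eqP.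
Qed.

Lemma flux_small (e : R) : 0 < e ->
  exists N, forall p t, 0 <= p <= 1 -> (N <= t)%N -> flux p t <= e.
Proof.
move=> e0; have [N hN] := law_RB_uniform al01 e0.
exists N => p t p01 Nt; rewrite (le_trans (hN p t p01 Nt))//.
by apply: ler_piMr; [exact: ltW | case/andP: p01].
Qed.

Lemma red_limit_symm p : 0 <= p <= 1 -> red_limit p = 1 - red_limit (1 - p).
Proof.
move=> p01; have p01' : 0 <= 1 - p <= 1 by move: p01; lra.
apply/eqP; rewrite -subr_eq0 -normr_le0; apply/ler_addgt0Pl => e e0.
rewrite addr0; have [|N hN] := @flux_small (e / 2); first by rewrite divr_gt0.
have := red_limit_near N p01; have := red_limit_near N p01'.
have := hN p N p01 (leqnn N); have := hN (1 - p) N p01' (leqnn N).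
rewrite law_red_symm !ler_norml => h1 h2 /andP[h3 h4] /andP[h5 h6].
by apply/andP; split; lra.
Qed.

Lemma red_limit_gain : exists2 e : R, 0 < e & forall p, 0 < p < e -> p <= 1 -> p < red_limit p.
Proof.
have [e e0 he] := law_red_gain al01; exists e => // p pe p1.
have [h h0 [N hN]] := he p pe.
have p01 : 0 <= p <= 1 by case/andP: pe => /ltW -> _.
have [|M hM] := @flux_small (h / 2); first by rewrite divr_gt0.
have := hN (maxn N M) (leq_maxl _ _); have := hM p _ p01 (leq_maxr N M).
have := red_limit_near (maxn N M) p01.
rewrite ler_norml => /andP[h1 _] h2 h3; lra.
Qed.

Lemma continuous_law t w : continuous (fun p : R => law p t w).
Proof.
have cs n (F : R -> seq bool -> R) : (forall v, continuous (F^~ v)) ->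
    continuous (fun p => wsum n (F p)).
  elim: n F => [|n IHn] F cF x; first exact: cF.
  by apply: continuousD; apply: (IHn (fun p v => F p (_ :: v))) => v; apply: cF.
elim: t w => [|t IHt] w.
  elim: w => [|b w IHw]; first exact: cst_continuous.
  rewrite (_ : (fun p => _) = (fun p : R => (if b then p else 1 - p) * law p 0 w))//.
  move=> x; apply: continuousM; last exact: IHw.
  case: b; first exact: cvg_id.
  by apply: continuousB; [exact: cst_continuous | exact: cvg_id].
apply: (cs _ (fun p v => wsum _ (fun c =>
  bern al c * law p t v * (word_step v c == w)%:R))) => v.
apply: (cs _ (fun p c => bern al c * law p t v * (word_step v c == w)%:R)) => c x /=.
by apply: cvgMr_tmp; apply: cvgMl_tmp; exact: IHt.
Qed.

(** At a time when the flux is small for all [p], the density, a polynomial in [p], is uniformly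
    close to the limit. *)
Lemma red_limit_continuous : {within `[0, 1], continuous red_limit}.
Proof.
apply/subspace_continuousP => p0 /=; rewrite in_itv /= => p0I.
apply/cvgrPdist_le => e e0.
have e3 : 0 < e / 3 by rewrite divr_gt0.
have [N hN] := flux_small e3.
have /cvgrPdist_le/(_ _ e3) cont := @continuous_law N [:: true] p0.
rewrite near_withinE; near=> p; rewrite /= in_itv /= => pI.
have : `|red_density p0 N - red_density p N| <= e / 3 by near: p.
have := red_limit_near N pI; have := red_limit_near N p0I.
have := hN p N pI (leqnn N); have := hN p0 N p0I (leqnn N).
rewrite !ler_norml => h1 h2 /andP[h3 h4] /andP[h5 h6] /andP[h7 h8].
by apply/andP; split; lra.
Unshelve. all: by end_near.
Qed.

End Limit.

Lemma clamp01 (R : realType) (x : R) :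
  (0 <= Num.max 0 (Num.min 1 x)) * (Num.max 0 (Num.min 1 x) <= 1).
Proof. by rewrite le_max lexx ge_max ler01 ge_min lexx. Qed.

(* Clamped because [{i01 R}] also has to be inhabited for the parameters outside
   [[0, 1]], where [red_limit] is meaningless. *)
Definition fixation (R : realType) (al p : R) : {i01 R} :=
  Itv01 (clamp01 (red_limit al p)).1 (clamp01 (red_limit al p)).2.

Lemma fixationE (R : realType) (al p : R) : 0 < al < 1 -> 0 <= p <= 1 ->
  (fixation al p)%:num = red_limit al p.
Proof.
move=> al01 p01; have /andP[h0 h1] := red_limit01 al01 p01.
by rewrite /= (min_idPr h1) (max_idPr h0).
Qed.

(** * Weak convergence to the mixture *)

Section WeakLimit.
Variables (R : realType) (al p : R).
Hypothesis al01 : 0 < al < 1.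
Hypothesis p01 : 0 < p < 1.
Context d (T : measurableType d) (P : probability T R).
Variables (coin : bool -> int -> nat -> {RV P >-> bool}).
Variable xi0 : int -> {RV P >-> bool}.
Hypothesis rnd : chameleon_randomness al p coin xi0.

Definition constant_box n c : set config :=
  [set x | [seq x j | j <- box n] == nseq n.*2.+1 c].

Lemma measurable_constant_box n c : measurable (constant_box n c).
Proof.
apply: (measurable_map_eq (f := fun j (x : config) => x j)); exact: measurable_coord.
Qed.

Lemma constant_boxP n c x : constant_box n c x -> {in box n, x =1 fun=> c}.
Proof.
move=> /eqP e j jn.
have := map_f (x : int -> bool) jn.
by rewrite (e : map (x : int -> bool) (box n) = _) mem_nseq => /andP[_ /eqP].
Qed.

Lemma constant_box_disjoint n : constant_box n red `&` constant_box n blue = set0.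
Proof. by apply/seteqP; split=> x //= -[/eqP e1 /eqP /(etrans (esym e1))]. Qed.

Lemma constant_box_mem n c x : (forall j, x j = c) -> constant_box n c x.
Proof.
move=> xc; rewrite /constant_box.
have -> : n.*2.+1 = size (box n) by rewrite size_sites.
by apply/eqP; elim: (box n) => //= j s ->; rewrite xc.
Qed.

Lemma prob_law_constant_box t n c :
  prob (chameleon_law coin xi0 t) (constant_box n c) = law al p t (nseq n.*2.+1 c).
Proof.
have al01' := lt01W al01.
have p01' := lt01W p01.
have := prob_window al01' p01' rnd t (- n%:Z) (nseq n.*2.+1 c).
rewrite /prob /chameleon_law /distribution /pushforward /window size_nseq.
by move=> e; rewrite -[RHS]/(fine (_)%:E) -e.
Qed.

Lemma prob_mixture_dirac (a : {i01 R}) (E : set config) :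
  prob (mixture a (dirac all_red) (dirac all_blue)) E =
  a%:num * (all_red \in E)%:R + (1 - a%:num) * (all_blue \in E)%:R.
Proof.
rewrite /prob [X in fine X](_ : _ = (a%:num%:E * \d_all_red E +
  (1 - a%:num)%:E * \d_all_blue E)%E); last exact: measure_addE.
by rewrite !diracE.
Qed.

Lemma constant_box_all n c c' : ((fun=> c' : bool) \in constant_box n c) = (c' == c).
Proof.
apply/idP/eqP => [/set_mem /constant_boxP h|->].
  by rewrite -(h 0)// /box mem_sites; lia.
by apply/mem_set/constant_box_mem.
Qed.

Lemma law_nseq_le t n c : law al p t (nseq n.+1 c) <= law al p t [:: c].
Proof.
have p01' := lt01W p01.
by elim: n => // n; apply: le_trans; exact: law_cons_le.
Qed.

Lemma weak_limit : weakly_converges (chameleon_law coin xi0)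
  (mixture (fixation al p) (dirac all_red) (dirac all_blue)).
Proof.
have p01' := lt01W p01.
move=> f cf [M0 [_ hM]].
pose M := M0 + 1.
have fM x : `|f x| <= M by apply: hM => //; rewrite ltrDl.
have M_ge0 : 0 <= M by rewrite (le_trans _ (fM all_red)).
have mf := measurable_continuous_config cf.
have EI (mu : probability config R) :
    (\int[mu]_x (f x)%:E)%E = (Rintegral mu setT f)%:E.
  rewrite /Rintegral fineK//; apply: integrable_fin_num => //.
  apply: measurable_bounded_integrable => //.
    by rewrite (le_lt_trans (probability_le1 _ _))// ltry.
  exists M; split; first exact: num_real.
  by move=> N MN x _ /=; rewrite (le_trans (fM x))// ltW.
rewrite EI (_ : (fun t => _) = EFin \o
    (fun t => Rintegral (chameleon_law coin xi0 t) setT f)); last first.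
  by apply/funext => t; exact: EI.
apply: cvg_EFin; first by apply: nearW.
apply/cvgrPdist_le => e e0.
have e4 : 0 < e / 4 by rewrite divr_gt0.
have [n1 h1] := continuous_box all_red cf e4.
have [n2 h2] := continuous_box all_blue cf e4.
pose n := maxn n1 n2; pose m := n.*2.
have sub1 j : j \in box n1 -> j \in box n by rewrite !mem_sites; lia.
have sub2 j : j \in box n2 -> j \in box n by rewrite !mem_sites; lia.
(* This serves both the law at time [t] and the limit; the latter gives all its mass to the two
   boxes. *)
have bound (mu : probability config R) :
    `|Rintegral mu setT f - (f all_red * prob mu (constant_box n red) +
        f all_blue * prob mu (constant_box n blue))| <=
    e / 4 + M * (1 - prob mu (constant_box n red) - prob mu (constant_box n blue)).
  apply: Rintegral_concentrated => //.
  - exact: measurable_constant_box.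
  - exact: measurable_constant_box.
  - exact: constant_box_disjoint.
  - exact: ltW.
  - by move=> x hx; apply: h1 => j /sub1; exact: constant_boxP.
  - by move=> x hx; apply: h2 => j /sub2; exact: constant_boxP.
(* Each box mass will be within [D], the flux times [m.+1], of its limit. Missing mass costs
   [2 * M * D], the two colours [M * D] each, and [bound] costs [e / 4] twice, so [M * D <= e / 8]
   suffices; [M + 1] keeps the denominator positive. *)
have [|N hN] := @flux_small R al al01 (e / (8 * (M + 1) * m.+1%:R)).
  by rewrite divr_gt0// !mulr_gt0// ltr_wpDl.
exists N => // t /= Nt.
have fl := hN p t p01' Nt.
have := bound (chameleon_law coin xi0 t).
have := bound (mixture (fixation al p) (dirac all_red) (dirac all_blue)).
rewrite !prob_law_constant_box !prob_mixture_dirac !constant_box_all eqxx.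
rewrite (_ : (blue == red) = false)// (_ : (red == blue) = false)// !eqxx.
rewrite !mulr0 !mulr1 addr0 add0r fixationE//.
set I1 := Rintegral _ _ _; set I2 := Rintegral _ _ _.
have := law_nseq_red al01 p01' t m; have := law_nseq_blue t m al01 p01'.
have := law_nseq_le t m true; have := law_nseq_le t m false.
rewrite law_blue.
have := red_limit_near al01 t p01'.
set q := red_limit al p; set r := law al p t [:: true].
set x := law al p t [:: true; false].
set lR := law al p t (nseq m.+1 true); set lB := law al p t (nseq m.+1 false).
have x0 : 0 <= x by exact: law_ge0.
rewrite -/x in fl; rewrite subrr mulr0 addr0.
pose D := m.+1%:R * x.
have MD : (M + 1) * D <= e / 8.
  rewrite /D mulrCA mulrA (_ : e / 8 = m.+1%:R * (M + 1) * (e / (8 * (M + 1) * m.+1%:R))).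
    by rewrite ler_wpM2l// mulr_ge0// ler_wpDr.
  have M1 : M + 1 != 0 by rewrite lt0r_neq0// ltr_wpDl.
  have m1 : m.+1%:R != 0 :> R by rewrite pnatr_eq0.
  by move: m1 M1; move: m.+1%:R => k k0 M1; field; rewrite k0 M1.
have DE : D = m%:R * x + x by rewrite /D -natr1 mulrDl mul1r.
have D0 : 0 <= m%:R * x by rewrite mulr_ge0.
rewrite [`|q - r| <= _]ler_norml => /andP[qr rq] lB1 lR1 lB2 lR2 hI1 hI2.
have hR : `|q - lR| <= D by rewrite ler_norml; apply/andP; split; lra.
have hB : `|1 - q - lB| <= D by rewrite ler_norml; apply/andP; split; lra.
have hC : M * (1 - lR - lB) <= M * (2 * D) by rewrite ler_wpM2l//; lra.
have haR : `|f all_red * (q - lR)| <= M * D by rewrite normrM ler_pM.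
have hbB : `|f all_blue * (1 - q - lB)| <= M * D by rewrite normrM ler_pM.
move: hI1 hI2 haR hbB; rewrite !ler_norml => /andP[? ?] /andP[? ?] /andP[? ?] /andP[? ?].
have MD1 : (M + 1) * D = M * D + D by rewrite mulrDl mul1r.
by apply/andP; split; lra.
Qed.

End WeakLimit.

Theorem theorem2 (R : realType) :
  exists pi : R -> R -> {i01 R},
    (forall alpha p : R, 0 < alpha < 1 -> 0 < p < 1 ->
      forall (d : measure_display) (T : measurableType d) (P : probability T R)
        (coin : bool -> int -> nat -> {RV P >-> bool})
        (xi0 : int -> {RV P >-> bool}),
      chameleon_randomness alpha p coin xi0 ->
      weakly_converges (chameleon_law coin xi0)
        (mixture (pi alpha p) (dirac all_red) (dirac all_blue))) /\
    (forall alpha : R, 0 < alpha < 1 ->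
      (pi alpha 0)%:num = 0 /\ (pi alpha 1)%:num = 1) /\
    (forall alpha : R, 0 < alpha < 1 ->
      {within `[0, 1], continuous (fun p : R => (pi alpha p)%:num)}) /\
    ((forall alpha p : R, 0 < alpha < 1 -> 0 < p < 1 ->
        (pi alpha p)%:num = 1 - (pi alpha (1 - p))%:num) /\
     (forall alpha : R, 0 < alpha < 1 -> (pi alpha 2^-1)%:num = 2^-1)) /\
    (forall alpha p : R, 0 < alpha < 1 -> 0 < p < 1 ->
      p ^+ 2 < (pi alpha p)%:num < 2 * p - p ^+ 2) /\
    (forall alpha : R, 0 < alpha < 1 ->
      exists2 eps : R, 0 < eps &
        forall p : R, 0 < p < eps -> p < (pi alpha p)%:num).
Proof.
have itvC (p : R) : 0 <= p <= 1 -> 0 <= 1 - p <= 1 by lra.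
exists (@fixation R); split=> [al p al01 p01 d T P coin xi0|]; first exact: weak_limit.
split=> [al al01|].
  by rewrite !fixationE ?lexx ?ler01// red_limit0 ?red_limit1.
split=> [al al01|].
  apply: subspace_eq_continuous (red_limit_continuous al01) => p.
  rewrite inE /= in_itv /= => p01.
  exact: esym (fixationE al01 p01).
split.
  have symm (al p : R) : 0 < al < 1 -> 0 < p < 1 ->
      (fixation al p)%:num = 1 - (fixation al (1 - p))%:num.
    move=> al01 /lt01W p01.
    rewrite (fixationE al01 p01) (fixationE al01 (itvC _ p01)).
    exact: red_limit_symm.
  split=> // al al01; have := symm al 2^-1 al01.
  rewrite (_ : 1 - 2^-1 = 2^-1 :> R); last by field.
  by move=> h; have := h _; lra.
split=> [al p al01 p01|al al01].
  by rewrite fixationE ?lt01W//; exact: red_limit_bounds.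
have [e e0 he] := red_limit_gain al01.
(* The minimum with 1 keeps [p] where [fixation] agrees with [red_limit]. *)
exists (Num.min e 1) => [|p /andP[p0]]; first by rewrite lt_min e0 ltr01.
rewrite lt_min => /andP[pe p1]; rewrite fixationE ?lt01W ?p0//.
by apply: he; rewrite ?p0 ?ltW.
Qed.
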